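(* Let $\alpha>-1$, $\mu\in\mathbb{N}$, $\delta\in\mathbb{R}$ with $\alpha+\delta>-1$, let $g\in C^{\infty}[0,\infty)$, and let $$f(x)=x^{\delta}\ln^{\mu}(x)\,g(x),\qquad x>0,$$ be such that $\int_0^{\infty}e^{-x}x^{\alpha}f(x)\,\mathrm{d}x<\infty$. Let $k$ be the smallest nonnegative integer greater than or equal to $\alpha+2\delta+\frac12$, and suppose that $$\lim_{x\to\infty}e^{-x/2}x^{\alpha+i+1}f^{(i)}(x)=0\quad (i=0,1,\ldots,k),\qquad \int_b^{\infty}e^{-x/2}x^{\alpha+k+1}\left|f^{(k+1)}(x)\right|\mathrm{d}x<\infty,$$ where $b>0$ is a fixed constant. Then, as $n\to\infty$, the Laguerre coefficients $a_n(\alpha)$ of $f$ satisfy $$|a_n(\alpha)|=\mathcal{O}\left(n^{-\alpha-\delta-1}\ln^{\mu}(2\sqrt{n})\right).$$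
   Context: For $\alpha>-1$, $L_n^{(\alpha)}$ denotes the generalized Laguerre polynomial of degree $n$ (standard normalization), orthogonal on $[0,\infty)$ with respect to $\omega_\alpha(x)=x^\alpha e^{-x}$: $\int_0^\infty \omega_\alpha L_n^{(\alpha)}L_m^{(\alpha)}\,\mathrm{d}x=\sigma_n^{(\alpha)}\delta_{m,n}$ with $\sigma_n^{(\alpha)}=\Gamma(n+\alpha+1)/n!$. The Laguerre coefficients of $f$ are $a_n(\alpha)=\frac{1}{\sigma_n^{(\alpha)}}\int_0^\infty f(x)L_n^{(\alpha)}(x)\omega_\alpha(x)\,\mathrm{d}x$. The notation $\ln^{\mu}(y)$ means $(\ln y)^{\mu}$. *)

(* Defs.v *)
From HB Require Import structures.
From mathcomp Require Export all_boot all_order all_algebra.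
From mathcomp Require Export all_classical all_reals all_analysis.
Export Order.TTheory GRing.Theory Num.Theory.
Export numFieldNormedType.Exports.

Set Implicit Arguments.
Unset Strict Implicit.
Unset Printing Implicit Defensive.

Local Open Scope classical_set_scope.
Local Open Scope ring_scope.

(* g \in C^oo[0, +oo[ : [G j] is the j-th derivative of g on the closed
   half-line, difference quotients being taken inside [0, +oo[, so that the
   derivatives at 0 are one-sided. The values of g on ]-oo, 0[ are irrelevant. *)
Definition smooth_half_line (R : realType) (g : R -> R) : Prop :=
  exists G : nat -> R -> R,
    (forall x : R, 0 <= x -> G 0%N x = g x) /\
    (forall (j : nat) (x : R), 0 <= x ->
       (fun h : R => h^-1 * (G j (x + h) - G j x))
         @ within [set h : R | 0 <= x + h] (0 : R)^' --> G j.+1 x).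

(* Only meaningful for 0 < s. *)
Definition Gamma (R : realType) (s : R) : R :=
  \int[lebesgue_measure]_(t in `]0, +oo[) (t `^ (s - 1) * expR (- t)).

(* a (a - 1) ... (a - m + 1) / m! *)
Definition gbinom (R : realType) (a : R) (m : nat) : R :=
  (\prod_(i < m) (a - i%:R)) / m`!%:R.

(* sum_(j <= n) (-1)^j binom(n + alpha, n - j) x^j / j! *)
Definition laguerre (R : realType) (alpha : R) (n : nat) : {poly R} :=
  \poly_(j < n.+1) ((-1) ^+ j * gbinom (n%:R + alpha) (n - j) / j`!%:R).

Definition laguerre_weight (R : realType) (alpha x : R) : R :=
  x `^ alpha * expR (- x).

Definition laguerre_sigma (R : realType) (alpha : R) (n : nat) : R :=
  Gamma (n%:R + alpha + 1) / n`!%:R.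

(* The endpoint 0 is excluded because f need only be specified on ]0, +oo[. *)
Definition laguerre_coef (R : realType) (alpha : R) (f : R -> R) (n : nat) : R :=
  (laguerre_sigma alpha n)^-1 *
  \int[lebesgue_measure]_(x in `]0, +oo[)
    (f x * (laguerre alpha n).[x] * laguerre_weight alpha x).

(* Main.v *)
Require Import Defs.
From mathcomp Require Import all_boot all_order all_algebra.
From mathcomp Require Import all_classical all_reals all_analysis.
From mathcomp Require Import measurable_realfun ring lra.
Import Order.TTheory GRing.Theory Num.Theory.
Import numFieldNormedType.Exports.

(** The integral of [f L_n x^alpha e^(-x)] is split according to a Taylor expansion
    of [g] at 0: with [P] the Taylor polynomial of a high degree [J - 1],
    [f = x^delta ln^mu(x) P(x) + r(x)].

    The first part is a combination of the moments [I_n(m)] of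
    [x^(delta+j) ln^m x]. Integrating by parts against the derivative of
    [x^(alpha+1) e^(-x) L_n^(alpha+1)] gives the recurrence
    [(n+1) I_(n+1)(m) = (n - delta - j) I_n(m) - m I_n(m-1)], from which
    [I_n(m) = O(n^(-delta-j-1) ln^m n)] follows by induction on [m]: see
    [log_laguerre_moment_rec], [recurrence_growth] and
    [log_laguerre_moment_growth]. This part produces the rate of the theorem.

    The remainder [r] is flat at 0 and decays like [f] at infinity, so it can be
    integrated by parts [k + 1] times without boundary terms. Each step gains a
    factor [1/n] and raises the parameter of the Laguerre polynomial by 1. The last
    integral is estimated in absolute value with the bound
    [e^(-x/2) |L_n^beta(x)| <= C n^(beta/2 - 1/4) (1 + x^(-beta/2 - 1/4))], uniform on
    the whole half-line ([laguerre_sup_bound]), for [beta = alpha + k + 1]; the choice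
    of [k] makes the result [O(n^(-delta-1))] ([remainder_growth]).

    The uniform bound is the analytic core. In the variable [t = x^(1/2)] the function
    [u = e^(-t^2/2) t^(beta+1/2) L_n(t^2)] satisfies [u'' = - phi u] with
    [phi = 4n + 2 beta + 2 - t^2 - (beta^2 - 1/4)/t^2]. The adiabatic invariant
    [phi^(1/2) u^2 + phi^(-1/2) u'^2 + phi' u u' / (2 phi^(3/2))] changes by at most a
    constant factor between [t] of order [n^(-1/2)], where the power series bounds
    [L_n], and the point near the turning point where [phi] is of order [n^(1/3)]
    ([liouville_green_bound]); the short rest of the oscillatory region and the region
    beyond the turning point are covered by the decay of the energy and by convexity
    ([beyond_turning_point_bound]).

    Finally [1 / sigma_n = O(n^(-alpha))] by the functional equation of the Gamma
    function ([laguerre_sigma_inv_growth]). *)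

Set Implicit Arguments.
Unset Strict Implicit.
Unset Printing Implicit Defensive.

Local Open Scope classical_set_scope.
Local Open Scope ring_scope.

(** * Bounds for powers, exponentials and logarithms *)

Section elementary.
Context {R : realType}.
Implicit Types x y a b e : R.

Lemma exprn_le_expR x n : 0 <= x -> x ^+ n <= n`!%:R * expR x.
Proof.
move=> x0; rewrite mulrC -ler_pdivrMr ?ltr0n ?fact_gt0//.
case: n => [|n]; first by rewrite expr0 fact0 divr1 -expR0 ler_expR.
by apply: le_trans (expR_ge1Dxn n x0); rewrite lerDr.
Qed.

Lemma powRE x a : 0 < x -> x `^ a = expR (a * ln x).
Proof. by move=> x0; rewrite /powR gt_eqF. Qed.

Lemma powRDp x a b : 0 < x -> x `^ (a + b) = x `^ a * x `^ b.
Proof. by move=> x0; apply: powRD; apply/implyP => _; rewrite gt_eqF. Qed.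

Lemma powR_le_expR a e b : 0 < e -> 0 < b ->
  exists2 C : R, 0 < C & forall x, b <= x -> x `^ a <= C * expR (e * x).
Proof.
move=> e0 b0; have [m am] : exists m : nat, a <= m%:R.
  exists (Num.bound `|a|); apply: le_trans (ler_norm _) _.
  exact/ltW/archi_boundP.
exists (b `^ (a - m%:R) * (e ^- m * m`!%:R)).
  by rewrite !mulr_gt0 ?powR_gt0 ?invr_gt0 ?exprn_gt0 ?ltr0n ?fact_gt0.
move=> x bx; have x0 : 0 < x := lt_le_trans b0 bx.
rewrite -[in leLHS](subrK m%:R a) (powRDp _ _ x0) (powR_mulrn _ (ltW x0)) -!mulrA.
apply: ler_pM.
- by rewrite powR_ge0.
- by rewrite exprn_ge0// ltW.
- rewrite !powRE// ler_expR; apply: ler_wnM2l; first by rewrite subr_le0.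
  by rewrite ler_ln.
- rewrite ler_pdivlMl ?exprn_gt0// -exprMn.
  by apply: exprn_le_expR; rewrite mulr_ge0// ltW.
Qed.

(** Only [|y|^m <= m! exp(|y|)] is used, with [y = e ln x]: the exponential is then
    one of the two powers. *)
Lemma normr_lnX_le m e : 0 < e ->
  exists2 C : R, 0 < C & forall x, 0 < x ->
    `|ln x| ^+ m <= C * (x `^ e + x `^ (- e)).
Proof.
move=> e0; exists (e ^- m * m`!%:R).
  by rewrite mulr_gt0 ?invr_gt0 ?exprn_gt0 ?ltr0n ?fact_gt0.
move=> x x0; rewrite -mulrA ler_pdivlMl ?exprn_gt0// -exprMn.
apply: le_trans (exprn_le_expR _ _) _; first by rewrite mulr_ge0// ltW.
rewrite ler_wpM2l ?ler0n// !(powRE _ x0).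
have [l0|l0] := leP 0 (ln x).
- by rewrite ger0_norm// lerDl expR_ge0.
- by rewrite ltr0_norm// mulNr mulrN lerDr expR_ge0.
Qed.

End elementary.

(** * Derivation rules for lambda-expressions *)

Section derivation_rules.
Context {R : realType}.
Implicit Types (f g : R -> R) (x a b c : R).

Lemma derR_cst x c : is_derive x 1 (fun=> c) 0.
Proof. exact: is_derive_cst. Qed.

Lemma derR_id x : is_derive x 1 (fun y : R => y) 1.
Proof. exact: is_derive_id. Qed.

Lemma derR_add f g x a b : is_derive x 1 f a -> is_derive x 1 g b ->
  is_derive x 1 (fun y => f y + g y) (a + b).
Proof. exact: is_deriveD. Qed.

Lemma derR_opp f x a : is_derive x 1 f a -> is_derive x 1 (fun y => - f y) (- a).
Proof. exact: is_deriveN. Qed.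

Lemma derR_sub f g x a b : is_derive x 1 f a -> is_derive x 1 g b ->
  is_derive x 1 (fun y => f y - g y) (a - b).
Proof. exact: is_deriveB. Qed.

Lemma derR_mul f g x a b : is_derive x 1 f a -> is_derive x 1 g b ->
  is_derive x 1 (fun y => f y * g y) (a * g x + f x * b).
Proof.
move=> df dg; rewrite addrC [a * _]mulrC; exact: is_deriveM.
Qed.

Lemma derR_scale f c x a : is_derive x 1 f a ->
  is_derive x 1 (fun y => c * f y) (c * a).
Proof. by move=> df; exact: (@is_deriveZ _ _ _ f c x 1 a df). Qed.

Lemma derR_inv f x a : is_derive x 1 f a -> f x != 0 ->
  is_derive x 1 (fun y => (f y)^-1) (- (f x) ^- 2 * a).
Proof. by move=> df fx0; exact: is_deriveV. Qed.

Lemma derR_comp f g x a b : is_derive (g x) 1 f a -> is_derive x 1 g b ->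
  is_derive x 1 (fun y => f (g y)) (a * b).
Proof. exact: is_derive1_comp. Qed.

Lemma derR_expR f x a : is_derive x 1 f a ->
  is_derive x 1 (fun y => expR (f y)) (expR (f x) * a).
Proof. by apply: derR_comp; exact: is_derive_expR. Qed.

Lemma derR_powR b f x a : is_derive x 1 f a -> 0 < f x ->
  is_derive x 1 (fun y => f y `^ b) (b * f x `^ (b - 1) * a).
Proof. move=> df fx0; move: df; apply: (@derR_comp (@powR R ^~ b)); exact: is_derive1_powR. Qed.

Lemma derR_poly (p : {poly R}) f x a : is_derive x 1 f a ->
  is_derive x 1 (fun y => p.[f y]) (p^`().[f x] * a).
Proof. by apply: (@derR_comp (horner p)); exact: is_derive_poly. Qed.

Lemma derR_ln x : 0 < x -> is_derive x 1 (@ln R) x^-1.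
Proof. exact: is_derive1_ln. Qed.

Lemma derR_eq f x a b : is_derive x 1 f a -> a = b -> is_derive x 1 f b.
Proof. by move=> df <-. Qed.

Lemma derR_ext f g x a : (\forall y \near x, f y = g y) -> is_derive x 1 f a ->
  is_derive x 1 g a.
Proof. by move=> fg; apply: near_eq_is_derive; rewrite ?oner_eq0. Qed.

Lemma derive_continuous f x a : is_derive x 1 f a -> {for x, continuous f}.
Proof.
by move=> df; apply/differentiable_continuous/derivable1_diffP; case: df.
Qed.

End derivation_rules.

(** * Integrals on the open half-line *)

Section half_line.
Context {R : realType}.
Notation mu := (@lebesgue_measure R).
Notation D := (`]0%R, +oo[%classic : set R).
Implicit Types (f F H U V : R -> R).

Lemma measurable_fun_half_line f :
  (forall x : R, 0 < x -> {for x, continuous f}) -> measurable_fun D f.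
Proof.
move=> cf; apply: open_continuous_measurable_fun; first exact: interval_open.
by move=> x /set_mem/=; rewrite in_itv/= andbT; exact: cf.
Qed.

Lemma integrable_half_line_le f F :
  (forall x : R, 0 < x -> {for x, continuous f}) ->
  (forall x : R, 0 < x -> `|f x| <= F x) ->
  mu.-integrable D (EFin \o F) -> mu.-integrable D (EFin \o f).
Proof.
move=> cf fF iF; apply: le_integrable iF => //.
- by apply/measurable_EFinP; exact: measurable_fun_half_line.
- move=> x /=; rewrite in_itv/= andbT => x0; rewrite lee_fin.
  by rewrite (le_trans (fF _ x0))// ler_norm.
Qed.

Let I n : set R := `[n.+1%:R^-1, n.+1%:R]%classic.

Let mI n : measurable (I n). Proof. exact: measurable_itv. Qed.

Let nndI : nondecreasing_seq I.
Proof.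
apply/nondecreasing_seqP => n; rewrite subsetEset => x.
rewrite /I /= !in_itv/= => /andP[x1 x2]; apply/andP; split.
  by apply: le_trans x1; rewrite lef_pV2 ?posrE ?ltr0n// ler_nat.
by apply: le_trans x2 _; rewrite ler_nat.
Qed.

Let I_sub n : I n `<=` D.
Proof.
move=> x; rewrite /I/= !in_itv/= andbT => /andP[+ _]; apply: lt_le_trans.
by rewrite invr_gt0 ltr0n.
Qed.

Let ID (x : R) : 0 < x -> exists n, I n x.
Proof.
move=> x0; exists (Num.bound x + Num.bound x^-1)%N.
rewrite /I/= in_itv/=; apply/andP; split.
  rewrite -[leRHS]invrK lef_pV2 ?posrE ?ltr0n ?invr_gt0//.
  apply: le_trans (ltW (archi_boundP _)) _; first by rewrite invr_ge0 ltW.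
  by rewrite ler_nat leqW// leq_addl.
apply: le_trans (ltW (archi_boundP (ltW x0))) _.
by rewrite ler_nat -addnS leq_addr.
Qed.

Let bigcupI : \bigcup_n I n = D.
Proof.
apply/seteqP; split => [x [n _]|x]; first exact: I_sub.
by rewrite /= in_itv/= andbT => /ID[n Inx]; exists n.
Qed.

Let FTC_I F f n : (forall x : R, 0 < x -> is_derive x 1 F (f x)) ->
  (forall x : R, 0 < x -> {for x, continuous f}) ->
  (\int[mu]_(x in I n.+1) (f x)%:E = (F n.+2%:R)%:E - (F n.+2%:R^-1)%:E)%E.
Proof.
move=> dF cf; have n0 : 0 < n.+2%:R^-1 :> R by rewrite invr_gt0 ltr0n.
have cF x : 0 < x -> {for x, continuous F}.
  by move=> x0; apply/differentiable_continuous/derivable1_diffP; case: (dF x x0).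
rewrite /I; apply: continuous_FTC2.
- apply: (@lt_trans _ _ 1); last by rewrite ltr1n.
  by rewrite invf_lt1 ?ltr0n// ltr1n.
- apply: continuous_in_subspaceT => x /set_mem/=; rewrite in_itv/= => /andP[+ _].
  by move=> /(lt_le_trans n0); exact: cf.
- split.
  + move=> x; rewrite in_itv/= => /andP[+ _].
    by move=> /(lt_trans n0) /dF[].
  + by apply: cvg_at_right_filter; exact: cF.
  + by apply: cvg_at_left_filter; apply: cF; rewrite ltr0n.
- move=> x; rewrite in_itv/= => /andP[+ _] => /(lt_trans n0) /dF H.
  by rewrite derive1E derive_val.
Qed.

(** Monotone convergence along the intervals [[1/n, n]], on which the integral is
    a difference of two values of [F]. *)
Lemma integrable_bounded_primitive F f M :
  (forall x : R, 0 < x -> is_derive x 1 F (f x)) ->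
  (forall x : R, 0 < x -> {for x, continuous f}) ->
  (forall x : R, 0 < x -> 0 <= f x) -> (forall x : R, 0 < x -> `|F x| <= M) ->
  mu.-integrable D (EFin \o f).
Proof.
move=> dF cf f0 FM; apply/integrableP; split.
  by apply/measurable_EFinP; exact: measurable_fun_half_line.
under eq_integral => x /set_mem.
  rewrite /= in_itv/= andbT => x0; rewrite ger0_norm ?f0//.
  over.
apply: (@le_lt_trans _ _ (2 * M)%:E); last exact: ltry.
rewrite -bigcupI.
have : (\int[mu]_(x in I n) (f x)%:E @[n --> \oo] -->
    \int[mu]_(x in \bigcup_n I n) (f x)%:E)%E.
  apply: ge0_nondecreasing_set_cvg_integral => //.
  - move=> n; apply/measurable_EFinP; apply: measurable_funS (@I_sub n) _ => //.
    exact: measurable_fun_half_line.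
  - by move=> n x /I_sub; rewrite /= in_itv/= andbT lee_fin => /f0.
move=> /cvg_lim <-//; apply: lime_le.
  apply: ereal_nondecreasing_is_cvgn.
  apply: ge0_nondecreasing_set_nondecreasing_integral => //.
  - move=> n; apply/measurable_EFinP; apply: measurable_funS (@I_sub n) _ => //.
    exact: measurable_fun_half_line.
  - by move=> n x /I_sub; rewrite /= in_itv/= andbT lee_fin => /f0.
exists 1%N => // -[//|n] _; rewrite FTC_I// -EFinB lee_fin.
rewrite (le_trans (ler_norm _))// (le_trans (ler_normB _ _))//.
by rewrite mulr_natl mulr2n; apply: lerD; apply: FM; rewrite ?invr_gt0 ltr0n.
Qed.

(** Dominated convergence along the same intervals: the integral is the limit of
    [F n - F (1/n)]. *)
Lemma Rintegral_derivative_eq0 F f :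
  (forall x : R, 0 < x -> is_derive x 1 F (f x)) ->
  (forall x : R, 0 < x -> {for x, continuous f}) ->
  mu.-integrable D (EFin \o f) ->
  F x @[x --> 0^'+] --> (0 : R) -> F x @[x --> +oo] --> (0 : R) ->
  \int[mu]_(x in D) f x = 0.
Proof.
move=> dF cf fi F0 Foo; have mD : measurable D by exact: measurable_itv.
have [mf _] := integrableP _ _ _ fi.
have := @dominated_cvg _ _ R mu D mD
  (fun n => (EFin \o f) \_ (I n)) (EFin \o f) (fun x => `|(f x)%:E|)%E.
have mfI n : measurable_fun D ((EFin \o f) \_ (I n)).
  apply/measurable_restrict; [exact: mI|exact: mD|].
  by apply: (measurable_funS mD) mf => x [].
have fI x : D x -> ((EFin \o f) \_ (I n)) x @[n --> \oo] --> (EFin \o f) x.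
  rewrite /= in_itv/= andbT => /ID[n Inx].
  apply: cvg_near_cst; exists n => // m /= nm.
  by rewrite patchE mem_set//; move: Inx; apply/subsetPset/nndI.
have fi' := integrable_abse fi.
have fIle n x : D x -> (`|((EFin \o f) \_ (I n)) x| <= `|(f x)%:E|)%E.
  by move=> Dx; rewrite patchE; case: ifPn => // _; rewrite abse0.
have ffin x : D x -> `|(f x)%:E|%E \is a fin_num by [].
move=> /(_ mfI fI ffin fi' fIle).
have -> : (fun n => \int[mu]_(x in D) ((EFin \o f) \_ (I n)) x)%E =
    (fun n => \int[mu]_(x in I n) (f x)%:E)%E.
  apply/funext => n; rewrite -integral_mkcondr; congr (integral _ _ _).
  by apply/setIidPr; exact: I_sub.
move=> h; rewrite /Rintegral.
have h0 : (\int[mu]_(x in I n) (f x)%:E @[n --> \oo] --> 0%:E)%E.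
  rewrite -(cvg_shiftS (fun n => \int[mu]_(x in I n) (f x)%:E)%E) /=.
  under eq_fun do rewrite FTC_I// -EFinB.
  apply/cvg_EFin; first exact: nearW.
  rewrite /comp/= -[X in _ --> X](subr0 0); apply: cvgB.
  - move/cvg_pinftyP: Foo; apply.
    apply/cvgryPge => A; near=> n; apply: (@le_trans _ _ n%:R).
      by near: n; exact: nbhs_infty_ger.
    by rewrite ler_nat leqW.
  - move/cvg_at_rightP: F0; apply; split.
      by move=> n; rewrite invr_gt0 ltr0n.
    rewrite (cvg_shiftS (fun n => n.+1%:R^-1 : R)).
    exact: cvg_harmonic.
by rewrite (cvg_unique _ h h0).
Unshelve. all: by end_near. Qed.

Lemma integrable_half_lineZ f c :
  mu.-integrable D (EFin \o f) -> mu.-integrable D (EFin \o (fun x => c * f x)).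
Proof. by move=> fi; apply: (integrableZl _ c fi); exact: measurable_itv. Qed.

Lemma integrable_half_lineD f F :
  mu.-integrable D (EFin \o f) -> mu.-integrable D (EFin \o F) ->
  mu.-integrable D (EFin \o (fun x => f x + F x)).
Proof. by move=> fi Fi; apply: (integrableD _ fi Fi); exact: measurable_itv. Qed.

Lemma normr_Rintegral_le f F :
  mu.-integrable D (EFin \o f) -> mu.-integrable D (EFin \o F) ->
  (forall x : R, 0 < x -> `|f x| <= F x) ->
  `|\int[mu]_(x in D) f x| <= \int[mu]_(x in D) F x.
Proof.
move=> fi Fi fF; have mD : measurable D by exact: measurable_itv.
have h := @le_normr_Rintegral _ _ _ mu D f mD fi.
apply: (le_trans h); apply: le_Rintegral => //.
- by have := integrable_norm fi.
- by move=> x /=; rewrite in_itv/= andbT => /fF.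
Qed.

(** The majorant [x^a (1 + x)^(-a-2)] has the bounded primitive
    [(x / (1 + x))^(a+1) / (a + 1)]. *)
Lemma integrable_powR_expR (a e : R) : -1 < a -> 0 < e ->
  mu.-integrable D (EFin \o (fun x => x `^ a * expR (- e * x))).
Proof.
move=> a1 e0; have a10 : 0 < a + 1 by rewrite -ltrBlDr sub0r.
have dpow (x : R) : 0 < x ->
    is_derive x 1 (@powR R ^~ a) (a * x `^ (a - 1)).
  by move=> x0; exact: is_derive1_powR.
have [C C0 HC] := powR_le_expR (a + 2) e0 ltr01.
apply: (@integrable_half_line_le _
    (fun x => C * expR e * (x `^ a * (1 + x) `^ (- a - 2)))).
- move=> x x0; apply: continuousM.
    exact: derive_continuous (dpow _ x0).
  apply: continuous_comp; last exact: continuous_expR.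
  by apply: continuousM; [exact: cst_continuous|exact: id].
- move=> x x0; have x10 : 0 < 1 + x by rewrite addr_gt0.
  rewrite ger0_norm ?mulr_ge0 ?powR_ge0 ?expR_ge0//.
  rewrite mulrCA ler_wpM2l ?powR_ge0//.
  have -> : - a - 2 = - (a + 2) by ring.
  rewrite powRN ler_pdivlMr ?powR_gt0// mulrC mulNr expRN ler_pdivrMr ?expR_gt0//.
  apply: le_trans (HC _ _) _; first by rewrite lerDl ltW.
  by rewrite mulrDr mulr1 expRD mulrA.
apply: integrable_half_lineZ.
pose F (x : R) := (a + 1)^-1 * (x * (1 + x)^-1) `^ (a + 1).
apply: (@integrable_bounded_primitive F _ (a + 1)^-1).
- move=> x x0; have x10 : 0 < 1 + x by rewrite addr_gt0.
  have q0 : 0 < x * (1 + x)^-1 by rewrite divr_gt0.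
  have d1 : is_derive x 1 (fun y => 1 + y) 1.
    by apply: derR_eq (derR_add (derR_cst x 1) (derR_id x)) _; rewrite add0r.
  have d2 : is_derive x 1 (fun y => y * (1 + y)^-1) ((1 + x) ^- 2).
    apply: derR_eq (derR_mul (derR_id x) (derR_inv d1 (lt0r_neq0 x10))) _.
    by field; rewrite gt_eqF.
  rewrite /F; apply: derR_eq (derR_scale (a + 1)^-1 (derR_powR (a + 1) d2 q0)) _.
  rewrite addrK !mulrA mulVf ?gt_eqF// mul1r.
  rewrite powRM ?invr_ge0 ?ltW// -mulrA; congr (_ * _).
  rewrite -[(1 + x)^-1](powR_inv1 (ltW x10)) -powRrM mulN1r.
  rewrite -powR_invn ?ltW// -powRD; first by congr (_ `^ _); rewrite opprD.
  by apply/implyP => _; rewrite gt_eqF.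
- move=> x x0; have x10 : 0 < 1 + x by rewrite addr_gt0.
  apply: continuousM; first exact: derive_continuous (dpow _ x0).
  have d1 : is_derive x 1 (fun y => 1 + y) 1.
    by apply: derR_eq (derR_add (derR_cst x 1) (derR_id x)) _; rewrite add0r.
  exact: derive_continuous (derR_powR (- a - 2) d1 x10).
- by move=> x x0; rewrite mulr_ge0 ?powR_ge0.
- move=> x x0; have x10 : 0 < 1 + x by rewrite addr_gt0.
  have q0 : 0 < x * (1 + x)^-1 by rewrite divr_gt0.
  rewrite /F ger0_norm; last by rewrite mulr_ge0 ?powR_ge0 ?invr_ge0 ?ltW.
  rewrite ger_pMr ?invr_gt0// powRE// -[leRHS]expR0 ler_expR.
  apply: mulr_ge0_le0; first exact: ltW.
  by apply: ln_le0; rewrite ler_pdivrMr// mul1r lerDr ler01.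
Qed.

(** Integration by parts: [H] is the product whose boundary values vanish, [U]
    and [V] are the two halves of its derivative. *)
Lemma Rintegral_by_parts H U V :
  (forall x : R, 0 < x -> is_derive x 1 H (U x + V x)) ->
  (forall x : R, 0 < x -> {for x, continuous U}) ->
  (forall x : R, 0 < x -> {for x, continuous V}) ->
  mu.-integrable D (EFin \o U) -> mu.-integrable D (EFin \o V) ->
  H x @[x --> 0^'+] --> (0 : R) -> H x @[x --> +oo] --> (0 : R) ->
  \int[mu]_(x in D) U x = - \int[mu]_(x in D) V x.
Proof.
move=> dH cU cV iU iV H0 Hoo; have mD : measurable D by exact: measurable_itv.
apply/eqP; rewrite -addr_eq0; apply/eqP; rewrite -RintegralD//.
apply: (@Rintegral_derivative_eq0 H) => //; last exact: integrable_half_lineD.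
by move=> x x0; apply: continuousD; [exact: cU|exact: cV].
Qed.

End half_line.

(** * Sequences bounded by first-order recurrences *)

Section growth.
Context {R : realType}.
Implicit Types (s c K : R) (u l : nat -> R).

Lemma ln_succ_bounds (n : nat) : (0 < n)%N ->
  (n.+1%:R^-1 : R) <= ln (n.+1%:R : R) - ln (n%:R : R) <= n%:R^-1.
Proof.
move=> n0; have n0R : 0 < n%:R :> R by rewrite ltr0n.
have n1R : 0 < n.+1%:R :> R by rewrite ltr0n.
rewrite -ln_div ?posrE//; apply/andP; split.
- rewrite -[leLHS]opprK -[leRHS]opprK lerN2 -lnV ?posrE ?divr_gt0//.
  rewrite invf_div.
  have -> : n%:R / n.+1%:R = 1 + - n.+1%:R^-1 :> R.
    by rewrite -natr1; field; rewrite natr1 gt_eqF.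
  by apply: le_ln1Dx; rewrite ltrN2 invf_lt1// ltr1n.
- rewrite -natr1 mulrDl divff ?gt_eqF// mul1r; apply: le_ln1Dx.
  by apply: lt_trans (_ : 0 < _); rewrite ?ltrN10// invr_gt0.
Qed.

(** The factor [1 + s/n + c/n^2] is at most [((n+1)/n)^s exp(A/n - A/(n+1))]
    with [A = |s| + 2 c], so [u n * n^(-s) * exp(A/n)] grows only through the
    inhomogeneous term. *)
Lemma recurrence_growth s c K u l (n0 : nat) : (0 < n0)%N -> 0 <= c -> 0 <= K ->
  (forall n, (n0 <= n)%N -> 0 <= u n) ->
  (forall n, (n0 <= n)%N -> 0 <= l n <= l n.+1) ->
  (forall n, (n0 <= n)%N -> u n.+1 <=
     (1 + s / n%:R + c / n%:R ^+ 2) * u n + K * n%:R `^ (s - 1) * l n) ->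
  exists2 C : R, 0 < C & forall n, (n0 <= n)%N ->
    u n <= C * n%:R `^ s * (1 + l n * ln n%:R).
Proof.
move=> n00 c0 K0 u0 ll ule.
pose A := `|s| + 2 * c.
have A0 : 0 <= A by rewrite addr_ge0// mulr_ge0.
pose Y n := u n * expR (- s * ln n%:R + A / n%:R).
pose K' := K * expR (`|s| + A).
have K'0 : 0 <= K' by rewrite mulr_ge0 ?expR_ge0.
have step n : (n0 <= n)%N -> Y n.+1 <= Y n + K' * (l n / n%:R).
  move=> n0n; have n_gt0 := leq_trans n00 n0n.
  have nR : 0 < n%:R :> R by rewrite ltr0n.
  have nR1 : 0 < n.+1%:R :> R by rewrite ltr0n.
  have /andP[L1 L2] := ln_succ_bounds n_gt0.
  have i1 : n.+1%:R^-1 <= n%:R^-1 :> R by rewrite lef_pV2 ?posrE// ler_nat.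
  have i2 : n%:R^-1 <= 1 :> R by rewrite invf_le1// ler1n.
  have i3 : 0 < n.+1%:R^-1 :> R by rewrite invr_gt0.
  have i4 : n%:R^-1 - n.+1%:R^-1 = n%:R^-1 * n.+1%:R^-1 :> R.
    by rewrite -natr1; field; rewrite natr1 !gt_eqF.
  have i5 : n%:R^-1 <= 2 * n.+1%:R^-1 :> R.
    rewrite ler_pdivlMr// mulrC ler_pdivrMr// mulr_natl mulr2n -natr1 lerD2l.
    by rewrite ler1n.
  set p := n%:R^-1 in L2 i1 i2 i4 i5 *; set q := n.+1%:R^-1 in L1 i1 i3 i4 i5 *.
  have sl : s * p - s * (ln n.+1%:R - ln n%:R) <= `|s| * (p - q).
    have [s0|s0] := leP 0 s.
      by rewrite ger0_norm// -mulrBr ler_wpM2l// lerB.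
    rewrite ltr0_norm// -mulrBr; nra.
  have cp : c * p ^+ 2 <= 2 * c * (p - q).
    rewrite i4 expr2 -mulrA [2 * _]mulrCA ler_wpM2l//.
    rewrite mulrCA ler_wpM2l// ?invr_ge0//.
  apply: (@le_trans _ _ (((1 + s / n%:R + c / n%:R ^+ 2) * u n +
      K * n%:R `^ (s - 1) * l n) * expR (- s * ln n.+1%:R + A / n.+1%:R))).
    by rewrite ler_wpM2r ?expR_ge0// ule.
  rewrite mulrDl; apply: lerD.
    rewrite mulrAC mulrC ler_wpM2l ?u0//.
    apply: (@le_trans _ _ (expR (s * p + c * p ^+ 2) *
        expR (- s * ln n.+1%:R + A / n.+1%:R))).
      rewrite ler_wpM2r ?expR_ge0// -addrA.
      by apply: le_trans (expR_ge1Dx _); rewrite /p exprVn.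
    rewrite -expRD ler_expR -/q -/p /A; lra.
  rewrite powRE//.
  have pE : p = expR (- ln n%:R) by rewrite expRN lnK ?posrE.
  have -> : K * expR ((s - 1) * ln n%:R) * l n *
      expR (- s * ln n.+1%:R + A / n.+1%:R) = K * l n *
      (expR ((s - 1) * ln n%:R) * expR (- s * ln n.+1%:R + A / n.+1%:R)) by ring.
  have -> : K' * (l n / n%:R) = K * l n * (expR (`|s| + A) * p).
    by rewrite /K' /p; ring.
  rewrite ler_wpM2l ?mulr_ge0//; first by case/andP: (ll n n0n).
  rewrite pE.
  rewrite -!expRD ler_expR.
  have : - s * (ln n.+1%:R - ln n%:R) <= `|s|.
    apply: le_trans (ler_norm _) _; rewrite normrM normrN ler_piMr//.
    by rewrite ger0_norm ?(le_trans (ltW i3))// (le_trans L2).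
  have : A * q <= A by rewrite ler_piMr// (le_trans i1).
  rewrite -/q; lra.
have Yle n : (n0 <= n)%N -> Y n <= Y n0 + 2 * K' * (l n * ln n%:R).
  elim: n => [|n IH]; first by rewrite leqn0 => /eqP n00'; rewrite n00' in n00.
  rewrite leq_eqVlt => /orP[/eqP <-|].
    rewrite lerDl !mulr_ge0 ?ln_ge0 ?ler1n//.
    by case/andP: (ll n0 (leqnn _)).
  rewrite ltnS => n0n; have n_gt0 := leq_trans n00 n0n.
  apply: le_trans (step _ n0n) _.
  have {}IH := IH n0n.
  have /andP[l0 l1] := ll _ n0n.
  have /andP[L1 _] := ln_succ_bounds n_gt0.
  have nR1 : 0 < n.+1%:R :> R by rewrite ltr0n.
  have i5 : n%:R^-1 <= 2 * n.+1%:R^-1 :> R.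
    rewrite ler_pdivlMr// mulrC ler_pdivrMr ?ltr0n// mulr_natl mulr2n -natr1 lerD2l.
    by rewrite ler1n.
  have : K' * (l n / n%:R) <= 2 * K' * (l n * (ln n.+1%:R - ln n%:R)).
    have : l n * n%:R^-1 <= l n * (2 * (ln n.+1%:R - ln n%:R)).
      by rewrite ler_wpM2l// (le_trans i5)// ler_wpM2l.
    by move=> /(ler_wpM2l K'0); lra.
  have : 2 * K' * (l n * ln n.+1%:R) <= 2 * K' * (l n.+1 * ln n.+1%:R).
    by rewrite ler_wpM2l ?mulr_ge0// ler_wpM2r// ln_ge0// ler1n.
  move: IH; rewrite mulrBr mulrBr; lra.
have Y00 : 0 <= Y n0 by rewrite mulr_ge0 ?expR_ge0 ?u0.
exists (1 + Y n0 + 2 * K'); first by lra.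
move=> n n0n; have n_gt0 := leq_trans n00 n0n.
have nR : 0 < n%:R :> R by rewrite ltr0n.
have /andP[l0 _] := ll _ n0n.
have ln0 : 0 <= l n * ln n%:R by rewrite mulr_ge0// ln_ge0// ler1n.
have -> : u n = Y n * expR (s * ln n%:R - A / n%:R).
  by rewrite /Y -mulrA -expRD (_ : _ + _ = 0) ?expR0 ?mulr1//; ring.
rewrite powRE// [leRHS]mulrAC; apply: ler_pM.
- by rewrite mulr_ge0 ?u0 ?expR_ge0.
- exact: expR_ge0.
- by apply: le_trans (Yle _ n0n) _; nra.
- by rewrite ler_expR gerDl oppr_le0 divr_ge0// ltW.
Qed.

Lemma product_growth s c u (n0 : nat) : (0 < n0)%N -> 0 <= c ->
  (forall n, (n0 <= n)%N -> 0 <= u n) ->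
  (forall n, (n0 <= n)%N -> u n.+1 <= (1 + s / n%:R + c / n%:R ^+ 2) * u n) ->
  exists2 C : R, 0 < C & forall n, (n0 <= n)%N -> u n <= C * n%:R `^ s.
Proof.
move=> n00 c0 u0 ule.
have [||C C0 HC] := @recurrence_growth s c 0 u (fun=> 0) n0 n00 c0 (lexx 0) u0.
- by move=> n _; rewrite lexx.
- by move=> n n0n; rewrite mulr0 addr0 ule.
by exists C => // n /HC; rewrite mul0r addr0 mulr1.
Qed.

End growth.

(** * Limits at the ends of the half-line *)

Section limits_at_the_ends.
Context {R : realType}.
Implicit Types (F : R -> R) (a b C : R).

Lemma cvg0_at_right F C a : 0 < a ->
  (forall x : R, 0 < x <= 1 -> `|F x| <= C * x `^ a) ->
  F x @[x --> 0^'+] --> (0 : R).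
Proof.
move=> a0 FC.
have h : C * x `^ a @[x --> 0^'+] --> (0 : R).
  rewrite -[X in _ --> X](mulr0 C); apply: cvgM; first exact: cvg_cst.
  exact: powR_cvg0.
apply: (@squeeze_cvgr _ _ _ _ (fun x => - (C * x `^ a)) (fun x => C * x `^ a)) => //.
- near=> x; rewrite -ler_norml; apply: FC; apply/andP; split => //.
  by near: x; apply: nbhs_right_le.
- by rewrite -[X in _ --> X]oppr0; exact: cvgN.
Unshelve. all: by end_near. Qed.

Lemma cvg0_pinfty F C b : (forall x : R, b <= x -> `|F x| <= C * x^-1) ->
  F x @[x --> +oo] --> (0 : R).
Proof.
move=> FC.
have h : C * x^-1 @[x --> +oo] --> (0 : R).
  rewrite -[X in _ --> X](mulr0 C); apply: cvgM; first exact: cvg_cst.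
  apply/gtr0_cvgV0; last exact: cvg_id.
  by near=> x; near: x; exact: nbhs_pinfty_gt.
apply: (@squeeze_cvgr _ _ _ _ (fun x => - (C * x^-1)) (fun x => C * x^-1)) => //.
- near=> x; rewrite -ler_norml; apply: FC.
  by near: x; apply: nbhs_pinfty_ge; exact: num_real.
- by rewrite -[X in _ --> X]oppr0; exact: cvgN.
Unshelve. all: by end_near. Qed.

Lemma sum_exp_coeff_le (x : R) m : 0 <= x -> \sum_(j < m) x ^+ j / j`!%:R <= expR x.
Proof.
move=> x0; rewrite -(big_mkord xpredT (fun j => x ^+ j / j`!%:R)).
have h : nondecreasing_seq (series (exp_coeff x)).
  apply/nondecreasing_seqP => n; rewrite /series/= big_nat_recr//= lerDl.
  by rewrite /exp_coeff/= mulr_ge0 ?exprn_ge0 ?invr_ge0.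
exact: (nondecreasing_cvgn_le h (is_cvg_series_exp_coeff x)).
Qed.

End limits_at_the_ends.

(** * Identities for Laguerre polynomials *)

Section laguerre_algebra.
Context {R : realType}.
Implicit Types (a b x : R).

Let S_neq0 m : m%:R + 1 != 0 :> R. Proof. by rewrite natr1 pnatr_eq0. Qed.

Let SS_neq0 m : m%:R + 1 + 1 != 0 :> R. Proof. by rewrite natr1 S_neq0. Qed.

Let fact_neq0 m : m`!%:R != 0 :> R.
Proof. by rewrite pnatr_eq0 -lt0n fact_gt0. Qed.

Lemma gbinomS a m : gbinom a m.+1 = gbinom a m * (a - m%:R) / m.+1%:R.
Proof.
rewrite /gbinom big_ord_recr/= factS natrM -natr1; field.
by rewrite fact_neq0 S_neq0.
Qed.

Lemma gbinom_pascal a m : gbinom (a + 1) m.+1 = gbinom a m.+1 + gbinom a m.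
Proof.
elim: m => [|m IH].
  by rewrite !gbinomS /gbinom !big_ord0 fact0; field.
rewrite gbinomS IH [gbinom a m.+2]gbinomS gbinomS -[m.+2%:R]natr1 -[m.+1%:R]natr1.
by field; rewrite SS_neq0 S_neq0.
Qed.

Lemma gbinomD1 a m : gbinom (a + 1) m.+1 = gbinom a m * (a + 1) / m.+1%:R.
Proof.
elim: m => [|m IH].
  by rewrite !gbinomS /gbinom !big_ord0 fact0; field.
rewrite gbinomS IH [gbinom a m.+1]gbinomS -[m.+2%:R]natr1 -[m.+1%:R]natr1.
by field; rewrite SS_neq0 S_neq0.
Qed.

Lemma laguerre_coefE b n j : (laguerre b n)`_j =
  if (j <= n)%N then (-1) ^+ j * gbinom (n%:R + b) (n - j) / j`!%:R else 0.
Proof. by rewrite /laguerre coef_poly ltnS. Qed.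

Lemma deriv_laguerre b n : (laguerre b n.+1)^`() = - laguerre (b + 1) n.
Proof.
apply/polyP => j; rewrite coef_deriv coefN !laguerre_coefE ltnS subSS.
case: leqP => jn; last by rewrite mul0rn oppr0.
rewrite -[_ *+ j.+1]mulr_natr factS natrM exprS (_ : n.+1%:R + b = n%:R + (b + 1)).
  by rewrite -natr1; field; rewrite fact_neq0 S_neq0.
by rewrite -natr1; ring.
Qed.

(** The Laguerre equation; on coefficients it is the two-term recurrence
    [(j + 1) (j + b + 1) c_(j+1) = - (n - j) c_j]. *)
Lemma laguerre_eq b n x :
  x * (laguerre b n)^`()^`().[x] + (b + 1 - x) * (laguerre b n)^`().[x] +
  n%:R * (laguerre b n).[x] = 0.
Proof.
set L := laguerre b n.
suff /(congr1 (horner ^~ x)) : 'X * L^`()^`() + (b + 1)%:P * L^`() - 'X * L^`() +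
    n%:R *: L = 0.
  by rewrite !hornerE => <-; ring.
apply/polyP => j; rewrite !coefD coefN !coefXM coefCM coefZ coef0 !coef_deriv.
have L1 i : (i < n)%N -> i.+1%:R * (i%:R + b + 1) * L`_i.+1 = - (n - i)%:R * L`_i.
  move=> ni; rewrite !laguerre_coefE ni (ltnW ni) -[(n - i)%N](subnSK ni) gbinomS.
  rewrite exprS factS natrM.
  have -> : n%:R + b - (n - i.+1)%:R = i%:R + b + 1 by rewrite natrB// -natr1; ring.
  by field; rewrite fact_neq0 !nat1r !pnatr_eq0.
have dM i m : L`_i *+ m = m%:R * L`_i by rewrite mulr_natl.
have dM2 i m p : L`_i *+ m *+ p = p%:R * (m%:R * L`_i) by rewrite !mulr_natl.
have L2 : L`_n.+1 = 0 by rewrite laguerre_coefE ltnn.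
have L3 i : (n < i)%N -> L`_i = 0 by rewrite laguerre_coefE; case: leqP.
case: (ltngtP j n) => [jn|nj|->].
- have := L1 _ jn; rewrite natrB ?(ltnW jn)//.
  case: j jn => [|j] jn /=; rewrite ?dM2 ?dM -?[j.+2%:R]natr1 -?[j.+1%:R]natr1; lra.
- case: j nj => [//|j] nj /=.
  by rewrite (L3 j.+1)// (L3 j.+2) ?(leqW nj)// !mul0rn; ring.
- rewrite L2 mul0rn; case: eqP => [n0|/eqP]; last rewrite -lt0n => n0.
    have -> : n%:R = 0 :> R by rewrite n0.
    by ring.
  rewrite !prednK// L2 dM !mul0rn; ring.
Qed.

(** Since [L_(n+1)' = - L_n^(b+1)], this is the Laguerre equation of [L_(n+1)]. In
    divergence form it says that the derivative of [x^(b+1) e^(-x) L_n^(b+1)] is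
    [(n+1) x^b e^(-x) L_(n+1)^b]. *)
Lemma laguerre_raise b n x : x * (laguerre (b + 1) n)^`().[x] +
  (b + 1 - x) * (laguerre (b + 1) n).[x] = n.+1%:R * (laguerre b n.+1).[x].
Proof.
have := laguerre_eq b n.+1 x; rewrite deriv_laguerre derivN !hornerE; lra.
Qed.

Lemma laguerre_pascal b n :
  laguerre (b + 1) n.+1 = laguerre b n.+1 + laguerre (b + 1) n.
Proof.
apply/polyP => j; rewrite coefD !laguerre_coefE.
have -> : n.+1%:R + (b + 1) = n.+1%:R + b + 1 by ring.
have -> : n%:R + (b + 1) = n.+1%:R + b by rewrite -natr1; ring.
case: (ltngtP j n.+1) => [jn|nj|->].
- have jn' : (j <= n)%N by [].
  by rewrite jn' subSn// gbinom_pascal; ring.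
- by rewrite leqNgt (ltnW nj)/= addr0.
- by rewrite ?leqnn ?ltnn subnn /gbinom !big_ord0 addr0.
Qed.

Lemma gbinom_top_ge0 b n m : 0 <= b -> (m <= n)%N -> 0 <= gbinom (n%:R + b) m.
Proof.
move=> b0; elim: m => [|m IH] mn; first by rewrite /gbinom big_ord0 fact0 divr1.
have h : 0 <= n%:R + b - m%:R by rewrite addrAC addr_ge0// subr_ge0 ler_nat ltnW.
by rewrite gbinomS divr_ge0// mulr_ge0// IH// ltnW.
Qed.

(** Consecutive coefficients have a ratio of at most [n / (j + 1)]. *)
Lemma normr_laguerre_le b n x : 0 <= b -> 0 <= x ->
  `|(laguerre b n).[x]| <= gbinom (n%:R + b) n * expR (n%:R * x).
Proof.
move=> b0 x0.
have h j : (j <= n)%N ->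
    gbinom (n%:R + b) (n - j) <= gbinom (n%:R + b) n * n%:R ^+ j.
  elim: j => [|j IH] jn; first by rewrite subn0 expr0 mulr1.
  have := IH (ltnW jn); rewrite -(subnSK jn) gbinomS (subnSK jn).
  have -> : n%:R + b - (n - j.+1)%:R = j%:R + b + 1 by rewrite natrB// -natr1; ring.
  have g0 : 0 <= gbinom (n%:R + b) (n - j.+1) by rewrite gbinom_top_ge0// leq_subr.
  have jn0 : 0 < (n - j)%:R :> R by rewrite ltr0n subn_gt0.
  rewrite ler_pdivrMr// => H; rewrite exprSr mulrA.
  have G0 : 0 <= gbinom (n%:R + b) n * n%:R ^+ j.
    by rewrite mulr_ge0 ?exprn_ge0// gbinom_top_ge0.
  apply: (@le_trans _ _ (gbinom (n%:R + b) (n - j.+1) * (j%:R + b + 1))).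
    by rewrite ler_peMr// lerDr addr_ge0.
  by apply: le_trans H _; rewrite ler_wpM2l// ler_nat leq_subr.
rewrite (@horner_coef_wide _ n.+1) ?size_poly//; apply: le_trans (ler_norm_sum _ _ _) _.
apply: le_trans (ler_wpM2l _ (sum_exp_coeff_le n.+1 _)); last 2 first.
- by rewrite gbinom_top_ge0.
- by rewrite mulr_ge0.
rewrite mulr_sumr; apply: ler_sum => i _; have iN : (i <= n)%N by rewrite -ltnS.
have g0 : 0 <= gbinom (n%:R + b) (n - i) by rewrite gbinom_top_ge0// leq_subr.
have := h _ iN; rewrite laguerre_coefE iN.
move: (gbinom _ (n - i)) (gbinom _ n) g0 => g G g0 hi.
have f0 : 0 <= i`!%:R^-1 :> R by rewrite invr_ge0.
have y0 : 0 <= x ^+ i by rewrite exprn_ge0.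
rewrite -!mulrA normrM normrX normrN1 expr1n mul1r ger0_norm; last first.
  exact: (mulr_ge0 g0 (mulr_ge0 f0 y0)).
rewrite [_^-1 * _]mulrC exprMn -[n%:R ^+ i * _ * _]mulrA [leRHS]mulrA.
by apply: ler_wpM2r => //; exact: mulr_ge0.
Qed.

End laguerre_algebra.

(** * Amplitude bounds for [u'' = - phi u] *)

Section oscillation.
Context {R : realType}.
Implicit Types (f df : R -> R) (a b : R).

Lemma derive_le0_le f df a b : a <= b ->
  (forall x, a <= x <= b -> is_derive x 1 f (df x)) ->
  (forall x, a <= x <= b -> df x <= 0) -> f b <= f a.
Proof.
move=> ab fdf df0.
have [|x|c] := @MVT_segment R f df a b ab.
- move=> x; rewrite in_itv/= => /andP[/ltW ax /ltW xb].
  by apply: fdf; rewrite ax xb.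
- apply: derivable_within_continuous => y; rewrite in_itv/= => yab.
  by case: (fdf y yab).
- rewrite in_itv/= => cab fE; rewrite -subr_le0 fE.
  by rewrite mulr_le0_ge0 ?df0// subr_ge0.
Qed.

Variables (phi phi1 phi2 u u1 : R -> R).

(** The adiabatic invariant of the oscillator [u'' = - phi u]: with
    [kappa = phi' / (2 phi^(3/2))], the quantity
    [J = phi^(1/2) u^2 + phi^(-1/2) u'^2 + kappa u u'] has derivative
    [kappa' u u'], so its relative change is at most the variation of
    [kappa]; the function [G] absorbs the places where [kappa] increases. *)
Lemma liouville_green_bound (G g : R -> R) t1 t2 M :
  (forall t, t1 <= t <= t2 -> 0 < phi t) ->
  (forall t, t1 <= t <= t2 -> is_derive t 1 phi (phi1 t)) ->
  (forall t, t1 <= t <= t2 -> is_derive t 1 phi1 (phi2 t)) ->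
  (forall t, t1 <= t <= t2 -> is_derive t 1 u (u1 t)) ->
  (forall t, t1 <= t <= t2 -> is_derive t 1 u1 (- (phi t * u t))) ->
  (forall t, t1 <= t <= t2 -> is_derive t 1 G (g t)) ->
  let w t := Num.sqrt (phi t) in
  (forall t, t1 <= t <= t2 -> `|phi1 t| <= 2 * w t ^+ 3) ->
  (forall t, t1 <= t <= t2 ->
    let kappa1 := phi2 t / (2 * w t ^+ 3) - 3 / 4 * phi1 t ^+ 2 / w t ^+ 5 in
    `|kappa1| <= - (kappa1 + g t)) ->
  (forall t, t1 <= t <= t2 -> G t1 - G t <= M) ->
  forall t, t1 <= t <= t2 ->
    w t * u t ^+ 2 + u1 t ^+ 2 / w t <=
    3 * expR (M + 2) * (w t1 * u t1 ^+ 2 + u1 t1 ^+ 2 / w t1).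
Proof.
move=> phi0 dphi dphi1 du du1 dG w kap1 kapG GM t tI.
have [tt1 tt2] : t1 <= t /\ t <= t2 by apply/andP.
have sub s : t1 <= s <= t -> t1 <= s <= t2.
  by move=> /andP[-> /=] /le_trans; exact.
have w0 s : t1 <= s <= t2 -> 0 < w s by move=> /phi0; rewrite sqrtr_gt0.
have w2 s : t1 <= s <= t2 -> w s ^+ 2 = phi s.
  by move=> /phi0/ltW; exact: sqr_sqrtr.
pose kap s := phi1 s / (2 * w s ^+ 3).
pose J0 s := w s * u s ^+ 2 + u1 s ^+ 2 / w s.
pose J s := J0 s + kap s * (u s * u1 s).
have uu s : t1 <= s <= t2 -> 2 * `|u s * u1 s| <= J0 s.
  move=> sI; have w0s := w0 s sI.
  have wN0 : w s != 0 by rewrite gt_eqF.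
  have -> : J0 s = (w s * `|u s| - `|u1 s|) ^+ 2 / w s + 2 * `|u s * u1 s|.
    rewrite /J0 normrM -(real_normK (num_real (u s))).
    by rewrite -(real_normK (num_real (u1 s))); field.
  by rewrite lerDr divr_ge0 ?sqr_ge0// ltW.
have kap_le1 s : t1 <= s <= t2 -> `|kap s| <= 1.
  move=> sI; have d0 : 0 < 2 * w s ^+ 3 by rewrite mulr_gt0// exprn_gt0// w0.
  by rewrite /kap normrM normfV (gtr0_norm d0) ler_pdivrMr// mul1r kap1.
have kapJ s : t1 <= s <= t2 -> `|kap s * (u s * u1 s)| <= `|u s * u1 s|.
  by move=> sI; rewrite normrM ler_piMl// kap_le1.
have Jlow s : t1 <= s <= t2 -> J0 s <= 2 * J s.
  move=> sI; have := uu s sI; have := kapJ s sI.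
  rewrite ler_norml /J => /andP[k1 k2]; lra.
have Jup s : t1 <= s <= t2 -> J s <= 3 / 2 * J0 s.
  move=> sI; have := uu s sI; have := kapJ s sI.
  rewrite ler_norml /J => /andP[k1 k2]; lra.
pose kap1' s := phi2 s / (2 * w s ^+ 3) - 3 / 4 * phi1 s ^+ 2 / w s ^+ 5.
have dw s : t1 <= s <= t2 -> is_derive s 1 w ((2 * w s)^-1 * phi1 s).
  move=> sI.
  exact: (@derR_comp _ Num.sqrt phi s _ _ (is_derive1_sqrt (phi0 s sI)) (dphi s sI)).
have dkap s : t1 <= s <= t2 -> is_derive s 1 kap (kap1' s).
  move=> sI; have wN0 : w s != 0 by rewrite gt_eqF// w0.
  have dw3 : is_derive s 1 (fun r => 2 * w r ^+ 3)
      (2 * (3 * w s ^+ 2 * ((2 * w s)^-1 * phi1 s))).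
    apply: derR_scale; have dws := dw s sI.
    apply: derR_eq (derR_mul dws (derR_mul dws dws)) _; ring.
  apply: derR_eq (derR_mul (dphi1 s sI) (derR_inv dw3 _)) _.
    by rewrite mulf_neq0// ?expf_neq0// gt_eqF.
  by rewrite /kap1'; field.
have dJ s : t1 <= s <= t2 -> is_derive s 1 J (kap1' s * (u s * u1 s)).
  move=> sI; have wN0 : w s != 0 by rewrite gt_eqF// w0.
  have du2 := derR_mul (du s sI) (du s sI).
  have du12 := derR_mul (du1 s sI) (du1 s sI).
  have duu := derR_mul (du s sI) (du1 s sI).
  apply: derR_eq (derR_add (derR_add (derR_mul (dw s sI) du2)
    (derR_mul du12 (derR_inv (dw s sI) wN0))) (derR_mul (dkap s sI) duu)) _.
  by rewrite /kap -(w2 s sI); field.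
pose H s := kap s + G s.
have dH s : t1 <= s <= t2 -> is_derive s 1 H (kap1' s + g s).
  by move=> sI; apply: derR_add; [exact: dkap|exact: dG].
have t1I : t1 <= t1 <= t2 by rewrite lexx (le_trans tt1).
have step : J t * expR (H t) <= J t1 * expR (H t1).
  apply: (@derive_le0_le (fun s => J s * expR (H s)) (fun s =>
    kap1' s * (u s * u1 s) * expR (H s) + J s * (expR (H s) * (kap1' s + g s))))
      => // s /sub sI.
    by apply: derR_mul (dJ s sI) (derR_expR (dH s sI)).
  have := uu s sI; have := kapG s sI; have := Jlow s sI.
  have -> : forall k e j h' : R, k * (u s * u1 s) * e + j * (e * h') =
    e * (k * (u s * u1 s) + j * h') by move=> *; ring.
  rewrite /= -/(kap1' s); set k := kap1' s; set h := k + g s => l1 l2 l3.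
  rewrite pmulr_rle0 ?expR_gt0//.
  have : k * (u s * u1 s) <= - h * `|u s * u1 s|.
    by rewrite (le_trans (ler_norm _))// normrM ler_wpM2r.
  have : - h * `|u s * u1 s| <= - h * J s.
    by rewrite ler_wpM2l ?(le_trans (normr_ge0 k))//; lra.
  lra.
have Jt : J t <= J t1 * expR (M + 2).
  rewrite -(ler_pM2r (expR_gt0 (H t))) (le_trans step)// -mulrA -expRD.
  apply: ler_wpM2l.
    have := Jlow _ t1I; have := uu _ t1I; have := normr_ge0 (u t1 * u1 t1); lra.
  rewrite ler_expR /H; have := GM t tI.
  have := kap_le1 _ t1I; have := kap_le1 _ tI; rewrite !ler_norml; lra.
rewrite -/(J0 t) -/(J0 t1); apply: le_trans (Jlow t tI) _.
have := ler_wpM2r (expR_ge0 (M + 2)) (Jup _ t1I); lra.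
Qed.

(** The energy [phi u^2 + u'^2] decreases with [phi], which bounds [u'] up to
    the zero [T] of [phi]; after [T], the function [u^2] is convex, so it can
    stay bounded only by being nonincreasing. *)
Lemma beyond_turning_point_bound t2 T C : t2 <= T -> phi T = 0 ->
  (forall t, t2 <= t -> is_derive t 1 phi (phi1 t)) ->
  (forall t, t2 <= t -> is_derive t 1 u (u1 t)) ->
  (forall t, t2 <= t -> is_derive t 1 u1 (- (phi t * u t))) ->
  (forall t, t2 <= t -> phi1 t <= 0) ->
  (forall t, t2 <= t -> `|u t| <= C) ->
  forall t, t2 <= t -> `|u t| <=
    `|u t2| + (T - t2) * Num.sqrt (phi t2 * u t2 ^+ 2 + u1 t2 ^+ 2).
Proof.
move=> t2T phiT dphi du du1 phi10 uC.
set D := Num.sqrt _.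
have phige t : t2 <= t <= T -> 0 <= phi t.
  move=> /andP[tt2 tT]; rewrite -phiT; apply: (@derive_le0_le phi phi1) => //.
  - by move=> x /andP[tx _]; apply: dphi; exact: le_trans tx.
  - by move=> x /andP[tx _]; apply: phi10; exact: le_trans tx.
have phile t : T <= t -> phi t <= 0.
  move=> tT; rewrite -phiT; apply: (@derive_le0_le phi phi1) => //.
  - by move=> x /andP[tx _]; apply: dphi; exact: le_trans tx.
  - by move=> x /andP[tx _]; apply: phi10; exact: le_trans tx.
have u1D t : t2 <= t <= T -> `|u1 t| <= D.
  move=> tI; have /andP[tt2 tT] := tI.
  have E : phi t * u t ^+ 2 + u1 t ^+ 2 <= phi t2 * u t2 ^+ 2 + u1 t2 ^+ 2.
    apply: (@derive_le0_le (fun t => phi t * u t ^+ 2 + u1 t ^+ 2)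
      (fun t => phi1 t * u t ^+ 2)) => //.
    - move=> x /andP[tx _]; apply: derR_eq (derR_add (derR_mul (dphi x tx)
        (derR_mul (du x tx) (du x tx))) (derR_mul (du1 x tx) (du1 x tx))) _.
      ring.
    - by move=> x /andP[tx _]; rewrite mulr_le0_ge0 ?phi10 ?sqr_ge0.
  rewrite -sqrtr_sqr ler_sqrt; last first.
    by rewrite addr_ge0 ?sqr_ge0// mulr_ge0 ?sqr_ge0// phige// lexx.
  by apply: le_trans E; rewrite lerDr mulr_ge0 ?sqr_ge0// phige.
have uT t : t2 <= t <= T -> `|u t| <= `|u t2| + (T - t2) * D.
  move=> tI; have /andP[tt2 tT] := tI.
  have [|x|c] := @MVT_segment R u u1 t2 t tt2.
  - by move=> x; rewrite in_itv/= => /andP[/ltW ax _]; exact: du.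
  - apply: derivable_within_continuous => y; rewrite in_itv/= => /andP[yt _].
    by case: (du y yt).
  - rewrite in_itv/= => /andP[c1 c2] uE.
    have -> : u t = u t2 + u1 c * (t - t2) by rewrite -uE; ring.
    apply: le_trans (ler_normD _ _) _; rewrite lerD2l normrM mulrC.
    apply: ler_pM => //; last by rewrite u1D// c1 (le_trans c2).
    by rewrite ger0_norm ?subr_ge0// lerD2r.
move=> t tt2; have [tT|/ltW Tt] := leP t T; first by rewrite uT// tt2 tT.
have uu1 s : T <= s -> u s * u1 s <= 0.
  move=> Ts; rewrite leNgt; apply/negP => e0.
  pose e := u s * u1 s.
  have grow r : s <= r -> e <= u r * u1 r.
    move=> sr; rewrite -lerN2.
    apply: (@derive_le0_le (fun r => - (u r * u1 r))
      (fun r => - (u1 r ^+ 2 - phi r * u r ^+ 2))) => //.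
    - move=> x /andP[sx _]; have tx := le_trans t2T (le_trans Ts sx).
      apply: derR_eq (derR_opp (derR_mul (du x tx) (du1 x tx))) _; ring.
    - move=> x /andP[sx _]; have := phile _ (le_trans Ts sx) => p0.
      rewrite oppr_le0 subr_ge0 (@le_trans _ _ 0) ?sqr_ge0//.
      by rewrite mulr_le0_ge0 ?sqr_ge0.
  have big r : s <= r -> 2 * e * (r - s) <= u r ^+ 2.
    move=> sr; have : 2 * e * r - u r ^+ 2 <= 2 * e * s - u s ^+ 2.
      apply: (@derive_le0_le (fun r => 2 * e * r - u r ^+ 2)
        (fun r => 2 * e - 2 * (u r * u1 r))) => //.
      - move=> x /andP[sx _]; have tx := le_trans t2T (le_trans Ts sx).
        apply: derR_eq (derR_sub (derR_scale (2 * e) (derR_id x)) (derR_mul (du x tx) (du x tx))) _.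
        ring.
      - by move=> x /andP[sx _]; rewrite subr_le0 ler_wpM2l// grow.
    have := sqr_ge0 (u s); lra.
  have sr : s <= s + (C ^+ 2 + 1) / (2 * e).
    by rewrite lerDl divr_ge0 ?addr_ge0 ?sqr_ge0// mulr_ge0// ltW.
  have := big _ sr; rewrite addrAC subrr add0r mulrC divfK; last first.
    by rewrite mulf_neq0// gt_eqF.
  have tr := le_trans t2T (le_trans Ts sr).
  rewrite -(real_normK (num_real (u _))) => H.
  have : `|u (s + (C ^+ 2 + 1) / (2 * e))| ^+ 2 <= C ^+ 2.
    by rewrite lerXn2r ?nnegrE ?uC// (le_trans _ (uC _ tr)).
  lra.
apply: le_trans (uT T _); last by rewrite t2T lexx.
rewrite -ler_sqr ?nnegrE// !real_normK ?num_real//.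
apply: (@derive_le0_le (fun t => u t ^+ 2) (fun t => 2 * (u t * u1 t))) => //.
- move=> x /andP[Tx _]; have tx := le_trans t2T Tx.
  by apply: derR_eq (derR_mul (du x tx) (du x tx)) _; ring.
- by move=> x /andP[Tx _]; rewrite mulr_ge0_le0// uu1.
Qed.

End oscillation.

Section model_oscillator.
Context {R : realType}.

(** [u'' = - phi u] with [phi t = 4 M^2 - t^2 - c / t^2]: the oscillatory
    region starts at distance of order [1 / M] from the origin, and the
    adiabatic invariant is followed up to the point [t2] where [phi] has come
    down to [e^2] with [e^3 = 3 M], where [kappa] reaches the size of a
    constant. *)
Lemma model_oscillator_bound (c M : R) (u u1 : R -> R) (C : R) :
  let A : R := 1 + `|c| in
  let phi (t : R) : R := 4 * M ^+ 2 - t ^+ 2 - c * t^-1 ^+ 2 in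
  let t1 : R := A / M in
  let B : R := 3 * expR 4 * (3 * M * u t1 ^+ 2 + u1 t1 ^+ 2 / M) in
  2 <= M -> 3 * `|c| + 1 <= M ^+ 2 ->
  (forall t : R, 0 < t -> is_derive t 1 u (u1 t)) ->
  (forall t : R, 0 < t -> is_derive t 1 u1 (- (phi t * u t))) ->
  (forall t : R, 1 <= t -> `|u t| <= C) ->
  (forall t : R, t1 <= t <= M -> M * u t ^+ 2 <= B) /\
  (forall t : R, M <= t -> `|u t| <= 8 * Num.sqrt B).
Proof.
move=> A phi t1 B M2 cM du du1 uC.
have AE : A = 1 + `|c| by [].
have phiE (t : R) : phi t = 4 * M ^+ 2 - t ^+ 2 - c * t^-1 ^+ 2 by [].
have t1E : t1 = A / M by [].
have BE : B = 3 * expR 4 * (3 * M * u t1 ^+ 2 + u1 t1 ^+ 2 / M) by [].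
have dphi0 (t : R) : 0 < t -> is_derive t 1 phi (- (2 * t) + 2 * c * t^-1 ^+ 3).
  move=> t0; have tN0 : t != 0 by rewrite gt_eqF.
  have di := derR_inv (derR_id t) tN0.
  apply: derR_eq (derR_sub (derR_sub (derR_cst t (4 * M ^+ 2))
    (derR_mul (derR_id t) (derR_id t))) (derR_scale c (derR_mul di di))) _.
  by field.
clearbody B; clearbody t1 phi; clearbody A.
have a0 : 0 <= `|c| := normr_ge0 c.
have M0 : 0 < M by lra.
have MN0 : M != 0 by rewrite gt_eqF.
have A1 : 1 <= A by rewrite AE; lra.
have A0 : 0 < A by lra.
have t10 : 0 < t1 by rewrite t1E divr_gt0.
have t1M : t1 <= M by rewrite t1E ler_pdivrMr// -expr2 AE; lra.
have [cl cu] : - `|c| <= c /\ c <= `|c|.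
  by split; [rewrite lerNl -normrN ler_norm|exact: ler_norm].
(* the scale e of phi^(1/2) near the turning point *)
have [e e3] : exists e : R, e ^+ 3 = 3 * M.
  exists ((3 * M) `^ 3^-1); rewrite -powR_mulrn ?powR_ge0// -powRrM.
  by rewrite mulVf// powRr1// mulr_ge0// ltW.
have e1 : 1 <= e.
  rewrite leNgt; apply/negP => e1.
  have : e ^+ 3 < 1.
    have [e0|/ltW e0] := leP 0 e; first by rewrite exprn_ilt1.
    apply: (@le_lt_trans _ _ 0) => //.
    by rewrite exprSr mulr_ge0_le0// sqr_ge0.
  by rewrite e3; lra.
have e2M : e ^+ 2 <= 3 * M by rewrite -e3 ler_weXn2l.
(* at t2, phi^(3/2) has come down to about e^3 = 3 M while |phi'| is about 4 M,
   so that |kappa| <= 1 still holds *)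
pose t2 := Num.sqrt (4 * M ^+ 2 - 1 - e ^+ 2).
have MM : 2 * M <= M ^+ 2 by rewrite expr2 ler_wpM2r// ltW.
have t22 : t2 ^+ 2 = 4 * M ^+ 2 - 1 - e ^+ 2 by rewrite sqr_sqrtr//; lra.
have Mt2 : M <= t2.
  by rewrite -(ler_sqr (ltW M0)) ?nnegrE ?sqrtr_ge0// t22; lra.
have t22M : t2 <= 2 * M.
  rewrite -ler_sqr ?nnegrE ?sqrtr_ge0 ?mulr_ge0 ?(ltW M0)// t22 exprMn.
  have := sqr_ge0 e; lra.
pose phi1 (t : R) : R := - (2 * t) + 2 * c * t^-1 ^+ 3.
pose phi2 (t : R) : R := - 2 - 6 * c * t^-1 ^+ 4.
have dphi (t : R) : 0 < t -> is_derive t 1 phi (phi1 t) by exact: dphi0.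
have dphi1 (t : R) : 0 < t -> is_derive t 1 phi1 (phi2 t).
  move=> t0; have tN0 : t != 0 by rewrite gt_eqF.
  have di := derR_inv (derR_id t) tN0.
  apply: derR_eq (derR_add (derR_opp (derR_scale 2 (derR_id t)))
    (derR_scale (2 * c) (derR_mul di (derR_mul di di)))) _.
  by rewrite /phi2; field.
have phi1E (t : R) : phi1 t = - (2 * t) + 2 * c * t^-1 ^+ 3 by [].
have phi2E (t : R) : phi2 t = - 2 - 6 * c * t^-1 ^+ 4 by [].
have t20' : 0 <= t2 by exact: sqrtr_ge0.
clearbody phi1 phi2 t2; clear dphi0.
have inv_le (s t : R) n : 0 < s -> s <= t -> 0 <= t^-1 ^+ n <= s^-1 ^+ n.
  move=> s0 st; have t0 := lt_le_trans s0 st.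
  rewrite exprn_ge0 ?invr_ge0 ?(ltW t0)//=.
  by apply: lerXn2r; rewrite ?nnegrE ?invr_ge0 ?(ltW t0) ?(ltW s0)// lef_pV2 ?posrE.
have csmall (t y z : R) : 0 <= y -> y <= z -> `|c| * z <= t -> - t <= c * y <= t.
  move=> y0 yz cz; have : `|c| * y <= `|c| * z by rewrite ler_wpM2l.
  have : c * y <= `|c| * y by rewrite ler_wpM2r.
  have : - `|c| * y <= c * y by rewrite ler_wpM2r.
  lra.
have cA n : `|c| * (t1^-1 ^+ n.+1) <= M ^+ n.+1.
  clear -A1 A0 AE t1E M0 a0.
  rewrite t1E invf_div exprMn mulrCA ler_piMr ?exprn_ge0 ?(ltW M0)//.
  rewrite exprVn ler_pdivrMr ?exprn_gt0// mul1r.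
  by apply: (@le_trans _ _ A); [rewrite AE; lra|rewrite ler_eXnr].
have cMM n : `|c| * (M^-1 ^+ n.+2) <= M^-1 ^+ n.
  clear -M0 cM a0.
  rewrite -addn2 exprD mulrCA ler_piMr ?exprn_ge0 ?invr_ge0 ?(ltW M0)//.
  by rewrite exprVn ler_pdivrMr ?exprn_gt0// mul1r; lra.
have zone1 (t : R) : t1 <= t <= M -> 2 * M ^+ 2 <= phi t /\ `|phi1 t| <= 4 * M ^+ 3.
  clear -phiE phi1E t10 inv_le csmall cA M2 M0.
  move=> /andP[tt1 tM]; have t0 := lt_le_trans t10 tt1.
  have /andP[y0 yz] := inv_le _ _ 2%N t10 tt1.
  have /andP[y0' yz'] := inv_le _ _ 3%N t10 tt1.
  have /andP[h1 h2] := csmall _ _ _ y0 yz (cA 1%N).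
  have /andP[h3 h4] := csmall _ _ _ y0' yz' (cA 2%N).
  have tM2 : t ^+ 2 <= M ^+ 2 by rewrite lerXn2r ?nnegrE// ltW.
  split; first by rewrite phiE; lra.
  have M3 : M <= M ^+ 3 by rewrite ler_eXnr//; lra.
  by rewrite ler_norml phi1E; apply/andP; split; lra.
have zone2 (t : R) : M <= t <= t2 -> e ^+ 2 <= phi t /\ `|phi1 t| <= 2 * e ^+ 3.
  clear -phiE phi1E M0 inv_le csmall cMM M2 e3 t20' t22 t22M.
  move=> /andP[tM tt2]; have t0 := lt_le_trans M0 tM.
  have /andP[y0 yz] := inv_le _ _ 2%N M0 tM.
  have /andP[y0' yz'] := inv_le _ _ 3%N M0 tM.
  have /andP[h1 h2] := csmall _ _ _ y0 yz (cMM 0%N).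
  have /andP[h3 h4] := csmall _ _ _ y0' yz' (cMM 1%N).
  have tM2 : t ^+ 2 <= t2 ^+ 2 by rewrite lerXn2r ?nnegrE ?sqrtr_ge0// ltW.
  rewrite expr0 in h1 h2; rewrite expr1 in h3 h4.
  have i1 : M^-1 <= 1 by rewrite invf_le1//; lra.
  split; first by rewrite phiE; lra.
  by rewrite e3 ler_norml phi1E; apply/andP; split; lra.
pose w (t : R) := Num.sqrt (phi t).
have phi_gt0 (t : R) : t1 <= t <= t2 -> 0 < phi t.
  clear -zone1 zone2 M0 e1.
  move=> /andP[tt1 tt2]; have [tM|/ltW Mt] := leP t M.
    have [h _] := zone1 t (introT andP (conj tt1 tM)).
    by apply: lt_le_trans h; rewrite mulr_gt0// exprn_gt0.
  have [h _] := zone2 t (introT andP (conj Mt tt2)).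
  by apply: lt_le_trans h; rewrite exprn_gt0//; lra.
have w_ge0 (t : R) : 0 <= w t by exact: sqrtr_ge0.
have w_sq (t : R) : 0 <= phi t -> w t ^+ 2 = phi t by move=> ?; rewrite sqr_sqrtr.
have w_ge (x t : R) : 0 <= x -> x ^+ 2 <= phi t -> x <= w t.
  move=> x0 xphi; rewrite -ler_sqr ?nnegrE//.
  by rewrite w_sq// (le_trans _ xphi)// sqr_ge0.
have wM (t : R) : t1 <= t <= M -> M <= w t.
  clear -zone1 w_ge M0.
  move=> tI; have [h _] := zone1 t tI; apply: w_ge; first exact: ltW.
  have := sqr_ge0 M; lra.
have we (t : R) : M <= t <= t2 -> e <= w t.
  clear -zone2 w_ge e1.
  by move=> tI; have [h _] := zone2 t tI; apply: w_ge => //; lra.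
have kap (t : R) : t1 <= t <= t2 -> `|phi1 t| <= 2 * w t ^+ 3.
  clear -zone1 zone2 wM we w_ge0 w_sq M0 e1.
  move=> /andP[tt1 tt2]; have [tM|/ltW Mt] := leP t M.
    have tI : t1 <= t <= M by rewrite tt1.
    have [h1 h2] := zone1 t tI; apply: le_trans h2 _.
    have : M * (2 * M ^+ 2) <= w t * w t ^+ 2.
      by apply: ler_pM; rewrite ?mulr_ge0 ?sqr_ge0 ?wM ?(ltW M0)// w_sq// (le_trans _ h1)// mulr_ge0 ?sqr_ge0.
    by rewrite [w t ^+ 3]exprS [M ^+ 3]exprS; lra.
  have tI : M <= t <= t2 by rewrite Mt.
  have [h1 h2] := zone2 t tI; apply: le_trans h2 _.
  by rewrite ler_wpM2l// lerXn2r ?nnegrE ?we//; lra.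
(* if c < 0, kappa may increase, but only where t^4 < 3 |c|; there phi >= M^2, so
   that kappa' <= 3 |c| M^(-3) t^(-4) *)
pose G (t : R) : R := 2 * `|c| * M^-1 ^+ 3 * t^-1 ^+ 3.
pose g (t : R) : R := - (6 * `|c| * M^-1 ^+ 3 * t^-1 ^+ 4).
have dG (t : R) : 0 < t -> is_derive t 1 G (g t).
  move=> t0; have tN0 : t != 0 by rewrite gt_eqF.
  have di := derR_inv (derR_id t) tN0.
  apply: derR_eq (derR_scale (2 * `|c| * M^-1 ^+ 3)
    (derR_mul di (derR_mul di di))) _.
  by rewrite /g; field; rewrite MN0 tN0.
have GE (t : R) : G t = 2 * `|c| * M^-1 ^+ 3 * t^-1 ^+ 3 by [].
have gE (t : R) : g t = - (6 * `|c| * M^-1 ^+ 3 * t^-1 ^+ 4) by [].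
clearbody G g.
have kapG (t : R) : t1 <= t <= t2 ->
    let kappa1 := phi2 t / (2 * w t ^+ 3) - 3 / 4 * phi1 t ^+ 2 / w t ^+ 5 in
    `|kappa1| <= - (kappa1 + g t).
  clear -t10 phi_gt0 w_ge w_ge0 M0 cM a0 phiE phi2E gE.
  move=> tI; set k := _ - _ => /=.
  have t0 : 0 < t by case/andP: tI => /(lt_le_trans t10).
  have w0 : 0 < w t by rewrite sqrtr_gt0 phi_gt0.
  have g0 : 0 <= - g t.
    by rewrite gE opprK !mulr_ge0 ?exprn_ge0 ?invr_ge0 ?(ltW M0) ?(ltW t0).
  have [k0|k0] := leP k 0; first by rewrite ler0_norm//; lra.
  rewrite gtr0_norm//.
  have kle : 2 * k <= phi2 t / w t ^+ 3.
    have : 0 <= 3 / 4 * phi1 t ^+ 2 / w t ^+ 5.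
      by apply: divr_ge0; [rewrite mulr_ge0 ?sqr_ge0|exact/exprn_ge0/w_ge0].
    have -> : phi2 t / w t ^+ 3 = 2 * (phi2 t / (2 * w t ^+ 3)).
      by field; rewrite gt_eqF.
    by rewrite /k; lra.
  have p2 : 0 < phi2 t.
    have k20 : 0 < 2 * k by rewrite mulr_gt0.
    have := lt_le_trans k20 kle.
    by rewrite pmulr_lgt0// invr_gt0 exprn_gt0.
  have y0 : 0 < t^-1 ^+ 4 by rewrite exprn_gt0// invr_gt0.
  have c0 : c < 0.
    rewrite ltNge; apply/negP => c0; move: p2; rewrite phi2E.
    by have := mulr_ge0 c0 (ltW y0); lra.
  have cE : `|c| = - c by rewrite ltr0_norm.
  have tc : t ^+ 2 <= 3 * `|c| + 1.
    have p3 : 2 * t ^+ 4 <= 6 * `|c|.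
      have := ler_wpM2l (exprn_ge0 4 (ltW t0)) (ltW p2).
      rewrite phi2E cE mulr0 => h.
      have tN0 : t != 0 by rewrite gt_eqF.
      have : t ^+ 4 * (-2 - 6 * c * t^-1 ^+ 4) = - 2 * t ^+ 4 - 6 * c by field.
      lra.
    have t4 : t ^+ 4 = (t ^+ 2) ^+ 2 by rewrite -exprM.
    rewrite leNgt; apply/negP => h; rewrite t4 in p3.
    have := sqr_ge0 (t ^+ 2 - 1); nra.
  have w3 : M <= w t.
    apply: w_ge; first exact: ltW.
    have : 0 <= - c * t^-1 ^+ 2 by rewrite mulr_ge0 ?sqr_ge0// -cE.
    rewrite phiE; have := sqr_ge0 M; lra.
  have p2le : phi2 t <= 6 * `|c| * t^-1 ^+ 4 by rewrite phi2E cE; lra.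
  suff : phi2 t / w t ^+ 3 <= - g t by lra.
  rewrite gE opprK mulrAC; apply: ler_pM => //; first exact: ltW.
    by rewrite invr_ge0 exprn_ge0.
  by rewrite exprVn lef_pV2 ?posrE ?exprn_gt0// lerXn2r ?nnegrE// ltW.
have GM (t : R) : t1 <= t <= t2 -> G t1 - G t <= 2.
  clear -t10 GE cA M0 MN0.
  move=> tI; have t0 : 0 < t by case/andP: tI => /(lt_le_trans t10).
  have : 0 <= G t by rewrite GE !mulr_ge0 ?exprn_ge0 ?invr_ge0 ?(ltW M0) ?(ltW t0).
  have : G t1 <= 2.
    have M30 : 0 <= 2 * M^-1 ^+ 3 by rewrite mulr_ge0 ?exprn_ge0 ?invr_ge0 ?(ltW M0).
    have := ler_wpM2l M30 (cA 2%N).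
    have -> : 2 * M^-1 ^+ 3 * M ^+ 3 = 2 by field.
    by rewrite GE; lra.
  lra.
have t1t2 : t1 <= t2 by exact: le_trans Mt2.
have t1I : t1 <= t1 <= M by rewrite lexx.
have B0 : 0 <= B.
  clear -BE M0.
  rewrite BE; apply: mulr_ge0; first by rewrite mulr_ge0 ?expR_ge0.
  apply: addr_ge0; first by rewrite mulr_ge0 ?sqr_ge0// mulr_ge0// ltW.
  by rewrite divr_ge0 ?sqr_ge0 ?(ltW M0).
have start : w t1 * u t1 ^+ 2 + u1 t1 ^+ 2 / w t1 <=
    3 * M * u t1 ^+ 2 + u1 t1 ^+ 2 / M.
  clear -zone1 t1I wM w_ge0 w_sq M0 csmall cA phiE.
  have h1 := wM _ t1I; have h2 := lt_le_trans M0 h1; apply: lerD; last first.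
    by rewrite ler_wpM2l ?sqr_ge0// lef_pV2 ?posrE.
  apply: ler_wpM2r; first exact: sqr_ge0.
  have [h _] := zone1 _ t1I.
  have M20 : 0 <= 2 * M ^+ 2 by rewrite mulr_ge0 ?sqr_ge0.
  rewrite -ler_sqr ?nnegrE ?mulr_ge0 ?(ltW M0)//.
  rewrite w_sq ?(le_trans M20)// phiE [(3 * M) ^+ 2]exprMn.
  have /andP[+ _] := csmall _ _ _ (sqr_ge0 t1^-1) (lexx _) (cA 1%N).
  have := sqr_ge0 t1; have := sqr_ge0 M; clear; lra.
have LG (t : R) : t1 <= t <= t2 -> w t * u t ^+ 2 + u1 t ^+ 2 / w t <= B.
  move=> tI; apply: le_trans (@liouville_green_bound _ phi phi1 phi2 u u1 G g
    t1 t2 2 phi_gt0 _ _ _ _ _ kap kapG GM t tI) _.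
  - by move=> s /andP[/(lt_le_trans t10)/dphi].
  - by move=> s /andP[/(lt_le_trans t10)/dphi1].
  - by move=> s /andP[/(lt_le_trans t10)/du].
  - by move=> s /andP[/(lt_le_trans t10)/du1].
  - by move=> s /andP[/(lt_le_trans t10)/dG].
  rewrite -/(w t1) (_ : 2 + 2 = 4 :> R); last by ring.
  by rewrite BE; apply: ler_wpM2l start; rewrite mulr_ge0 ?expR_ge0.
clear dphi1 dG kap kapG GM zone1 start GE gE BE G g phi2E phi2 cA.
split.
  move=> t tI; have tI2 : t1 <= t <= t2.
    by case/andP: tI => -> /= /le_trans; exact.
  apply: le_trans (LG _ tI2); apply: ler_wpDr.
    by rewrite divr_ge0 ?sqr_ge0.
  by rewrite ler_wpM2r ?sqr_ge0// wM.
have far (t : R) : M <= t <= t2 -> `|u t| <= Num.sqrt B.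
  clear -LG t1M we w_ge0 e1 B0.
  move=> /andP[Mt tt2]; rewrite -sqrtr_sqr ler_sqrt//.
  have tI : t1 <= t <= t2 by rewrite tt2 (le_trans t1M).
  apply: le_trans (LG _ tI); apply: ler_wpDr.
    by rewrite divr_ge0 ?sqr_ge0.
  by rewrite ler_peMl ?sqr_ge0// (le_trans e1)// we// Mt.
have B8 : Num.sqrt B <= 8 * Num.sqrt B by rewrite ler_peMl ?sqrtr_ge0// ler1n.
move=> t Mt; have [tt2|/ltW tt2] := leP t t2.
  by apply: le_trans B8; rewrite far// Mt.
have t20 : 0 < t2 := lt_le_trans M0 Mt2.
have t2I : M <= t2 <= t2 by rewrite Mt2 lexx.
have [T [t2T phiT]] : exists T : R, t2 <= T /\ phi T = 0.
  clear -dphi t20 t22M MM M2 M0 inv_le csmall cMM phiE zone2 t2I.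
  have t23 : t2 <= 3 * M by lra.
  have [||T] := @IVT R phi t2 (3 * M) 0 t23.
  - apply: derivable_within_continuous => y; rewrite in_itv/= => /andP[yt _].
    by case: (dphi y (lt_le_trans t20 yt)).
  - rewrite ge_min le_max; apply/andP; split; apply/orP.
      right; have M3 : M <= 3 * M by lra.
      have /andP[y0 yz] := inv_le _ _ 2%N M0 M3.
      have /andP[h1 _] := csmall _ _ _ y0 yz (cMM 0%N).
      by rewrite expr0 in h1; rewrite phiE [(3 * M) ^+ 2]exprMn; lra.
    left; apply: (le_trans (sqr_ge0 e)); by case: (zone2 _ t2I).
  - by rewrite in_itv/= => /andP[h _] phiT; exists T.
have phi10 (s : R) : t2 <= s -> phi1 s <= 0.
  clear -Mt2 inv_le M0 M2 csmall cMM phi1E.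
  move=> st2; have Ms := le_trans Mt2 st2.
  have /andP[y0 yz] := inv_le _ _ 3%N M0 Ms.
  have /andP[_ h2] := csmall _ _ _ y0 yz (cMM 1%N).
  rewrite expr1 in h2; have i1 : M^-1 <= 1 by rewrite invf_le1//; lra.
  by rewrite phi1E; lra.
apply: le_trans (@beyond_turning_point_bound _ phi phi1 u u1 t2 T C t2T phiT
  _ _ _ phi10 _ t tt2) _.
- by move=> s /(lt_le_trans t20)/dphi.
- by move=> s /(lt_le_trans t20)/du.
- by move=> s /(lt_le_trans t20)/du1.
- by move=> s st2; apply: uC; apply: le_trans st2; clear -Mt2 M2; lra.
have w2e : w t2 <= 2 * e.
  clear -e1 w_sq phi_gt0 w_ge0 t1t2 inv_le M0 Mt2 csmall cMM phiE t22.
  rewrite -ler_sqr ?nnegrE ?mulr_ge0//; last by lra.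
  rewrite w_sq ?(ltW (phi_gt0 _ _))//; last by rewrite t1t2 lexx.
  have /andP[y0 yz] := inv_le _ _ 2%N M0 Mt2.
  have /andP[h1 _] := csmall _ _ _ y0 yz (cMM 0%N).
  rewrite expr0 in h1; rewrite phiE [(2 * e) ^+ 2]exprMn t22.
  have : 1 <= e ^+ 2 by rewrite exprn_ege1.
  lra.
(* between t2 and the zero T, phi falls from about e^2 to 0 at a speed of order
   M = e^3 / 3 *)
have Te : (T - t2) * e <= 9 / 2.
  clear -Mt2 t2T inv_le M0 csmall cMM e1 phiT phiE t22 e3.
  have MT : M <= T := le_trans Mt2 t2T.
  have /andP[y0 yz] := inv_le _ _ 2%N M0 MT.
  have /andP[h1 _] := csmall _ _ _ y0 yz (cMM 0%N).
  rewrite expr0 in h1.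
  have e21 : 1 <= e ^+ 2 by rewrite exprn_ege1.
  have TT : (T - t2) * (T + t2) <= 3 * e ^+ 2.
    move: phiT; rewrite phiE => phiT.
    have -> : (T - t2) * (T + t2) = T ^+ 2 - t2 ^+ 2 by ring.
    rewrite t22; lra.
  have : (T - t2) * (2 * M) <= 3 * e ^+ 2.
    apply: le_trans TT; rewrite ler_wpM2l ?subr_ge0//; lra.
  have -> : 2 * M = 2 / 3 * e * e ^+ 2 by rewrite -mulrA -exprS e3; field.
  rewrite mulrA ler_pM2r ?(lt_le_trans _ e21)//; lra.
set D := Num.sqrt (_ + _).
have D2 : D <= Num.sqrt (2 * e * B).
  clear -D B0 e1 t1t2 w_sq phi_gt0 w_ge0 w2e LG.
  rewrite ler_sqrt; last by apply: mulr_ge0 => //; lra.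
  have t2I' : t1 <= t2 <= t2 by rewrite t1t2 lexx.
  have -> : phi t2 * u t2 ^+ 2 + u1 t2 ^+ 2 =
      w t2 * (w t2 * u t2 ^+ 2 + u1 t2 ^+ 2 / w t2).
    rewrite -(w_sq _ (ltW (phi_gt0 _ t2I'))); field.
    by rewrite gt_eqF// sqrtr_gt0 phi_gt0.
  apply: ler_pM; [exact: w_ge0| |exact: w2e|exact: LG].
  exact: addr_ge0 (mulr_ge0 (w_ge0 _) (sqr_ge0 _)) (divr_ge0 (sqr_ge0 _) (w_ge0 _)).
have TD : (T - t2) * D <= 7 * Num.sqrt B.
  clear -D2 t2T e1 Te B0.
  apply: le_trans (ler_wpM2l _ D2) _; first by rewrite subr_ge0.
  rewrite sqrtrM; last by rewrite mulr_ge0//; lra.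
  rewrite mulrA ler_wpM2r ?sqrtr_ge0//.
  have Tt0 : 0 <= T - t2 by rewrite subr_ge0.
  rewrite -ler_sqr ?nnegrE ?mulr_ge0 ?sqrtr_ge0//.
  rewrite exprMn sqr_sqrtr; last by rewrite mulr_ge0//; lra.
  have Te0 : 0 <= (T - t2) * e by rewrite mulr_ge0//; lra.
  have Tle : T - t2 <= (T - t2) * e by rewrite ler_peMr.
  have : (T - t2) ^+ 2 * (2 * e) = 2 * ((T - t2) * ((T - t2) * e)) by ring.
  have : (T - t2) * ((T - t2) * e) <= 9 / 2 * (9 / 2) by apply: ler_pM => //; lra.
  lra.
by have := far _ t2I; move: TD; clear; lra.
Qed.

End model_oscillator.

(** * A uniform bound for Laguerre polynomials *)

Section laguerre_bound.
Context {R : realType}.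

(** Exchanges two quantities of the same order under a power of either sign. *)
Lemma powR_comparable (a b K s : R) : 0 < a -> 0 < b -> a <= K * b -> b <= K * a ->
  a `^ s <= K `^ `|s| * b `^ s.
Proof.
move=> a0 b0 aKb bKa.
have K0 : 0 < K by rewrite -(pmulr_lgt0 _ b0) (lt_le_trans a0).
rewrite !powRE// -expRD ler_expR.
have h1 : ln a <= ln K + ln b by rewrite -lnM ?posrE// ler_ln ?posrE ?mulr_gt0.
have h2 : ln b <= ln K + ln a by rewrite -lnM ?posrE// ler_ln ?posrE ?mulr_gt0.
have [s0|s0] := leP 0 s; [rewrite ger0_norm//|rewrite ltr0_norm//]; nra.
Qed.

Lemma horner_le_expR (p : {poly R}) (e : R) : 0 < e ->
  exists2 C : R, 0 <= C & forall x, 0 <= x -> `|p.[x]| <= C * expR (e * x).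
Proof.
move=> e0; exists (\sum_(i < size p) `|p`_i| * (e ^- i * i`!%:R)).
  by apply: sumr_ge0 => i _; apply: mulr_ge0 => //; rewrite mulr_ge0 ?invr_ge0 ?exprn_ge0 ?(ltW e0).
move=> x x0; rewrite horner_coef mulr_suml; apply: le_trans (ler_norm_sum _ _ _) _.
apply: ler_sum => i _; rewrite normrM -mulrA; apply: ler_wpM2l => //.
rewrite normrX ger0_norm// -mulrA ler_pdivlMl ?exprn_gt0// -exprMn.
by apply: exprn_le_expR; rewrite mulr_ge0// ltW.
Qed.

Lemma gbinom_growth (b : R) : 0 <= b -> exists2 C : R, 0 < C &
  forall n, (0 < n)%N -> gbinom (n%:R + b) n <= C * n%:R `^ b.
Proof.
move=> b0; apply: (@product_growth _ b 0) => // n n0.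
- exact: gbinom_top_ge0.
- have -> : n.+1%:R + b = n%:R + b + 1 by rewrite -natr1; ring.
  rewrite gbinomD1 mul0r addr0 -mulrA mulrC ler_wpM2r ?gbinom_top_ge0//.
  have n1 : 0 < n%:R :> R by rewrite ltr0n.
  have n2 : 0 < n.+1%:R :> R by rewrite ltr0n.
  rewrite ler_pdivrMr// -natr1 mulrDr mulr1 mulrDl mul1r divfK ?gt_eqF//.
  have : 0 <= b / n%:R by rewrite divr_ge0// ltW.
  lra.
Qed.

Let gauss (b t : R) : R := expR (- (t * t) / 2) * t `^ (b + 2^-1).

Let gaussD (b t : R) : 0 < t ->
  is_derive t 1 (gauss b) (gauss b t * (- t + (b + 2^-1) / t)).
Proof.
move=> t0; have tN0 : t != 0 by rewrite gt_eqF.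
have d2 : is_derive t 1 (fun r : R => - (r * r) / 2) (- t).
  apply: derR_eq (derR_mul (derR_opp (derR_mul (derR_id t) (derR_id t)))
    (derR_cst t 2^-1)) _; by field.
apply: derR_eq (derR_mul (derR_expR d2) (derR_powR (b + 2^-1) (derR_id t) t0)) _.
rewrite (powRDp (b + 2^-1) (-1) t0) powRN powRr1 ?(ltW t0)// /gauss; by field.
Qed.

(** The variable [x = t^2] and the factor [e^(-t^2/2) t^(b+1/2)] remove the
    first-order term of the Laguerre equation, which turns it into the model
    oscillator with [M^2 = n + (b+1)/2] and [c = b^2 - 1/4]. *)
Lemma laguerre_liouville (b : R) n (t : R) : 0 < t ->
  let L := laguerre b n in
  let E r := expR (- (r * r) / 2) * r `^ (b + 2^-1) in
  let u r := E r * L.[r * r] in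
  let u1 r := E r * ((- r + (b + 2^-1) / r) * L.[r * r] + 2 * r * L^`().[r * r]) in
  is_derive t 1 u (u1 t) /\
  is_derive t 1 u1
    (- ((4 * (n%:R + (b + 1) / 2) - t ^+ 2 - (b ^+ 2 - 4^-1) * t^-1 ^+ 2) * u t)).
Proof.
move=> t0 L E u u1; have tN0 : t != 0 by rewrite gt_eqF.
have dE := gaussD b t0; rewrite -/(E t) in dE.
have d2 : is_derive t 1 (fun r : R => r * r) (2 * t).
  by apply: derR_eq (derR_mul (derR_id t) (derR_id t)) _; ring.
have dL := derR_poly L d2.
have dL1 := derR_poly L^`() d2.
have da : is_derive t 1 (fun r : R => - r + (b + 2^-1) / r)
    (- 1 - (b + 2^-1) / t ^+ 2).
  apply: derR_eq (derR_add (derR_opp (derR_id t)) (derR_scale (b + 2^-1)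
    (derR_inv (derR_id t) tN0))) _; by field.
split.
  by apply: derR_eq (derR_mul dE dL) _; rewrite /u1 /E /gauss; ring.
apply: derR_eq (derR_mul dE (derR_add (derR_mul da dL)
  (derR_mul (derR_scale 2 (derR_id t)) dL1))) _.
have ode : t * t * L^`()^`().[t * t] =
    - ((b + 1 - t * t) * L^`().[t * t] + n%:R * L.[t * t]).
  by have := laguerre_eq b n (t * t); rewrite -/L; lra.
rewrite /u /gauss -/(E t).
move: ode; move: (L^`()^`().[t * t]) (L^`().[t * t]) (L.[t * t]) (E t).
move=> L2 L1 L0 Et ode.
have -> : 2 * t * (L2 * (2 * t)) = 4 * (t * t * L2) by ring.
by rewrite ode; field.
Qed.

(** The interval [x <= A^2/M^2] next to the origin is covered by the bound
    [|L_n x| <= C n^b exp (n x)]; from there on the model oscillator takes over,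
    started with the same bound for [L_n] and for [L_n' = - L_(n-1)^(b+1)]. *)
Lemma laguerre_sup_bound (b : R) : 0 < b -> exists (C : R) (n0 : nat),
  0 < C /\ forall n, (n0 <= n)%N -> forall x : R, 0 < x ->
  expR (- x / 2) * `|(laguerre b n).[x]| <=
  C * n%:R `^ (b / 2 - 4^-1) * (1 + x `^ (- (b / 2 + 4^-1))).
Proof.
move=> b0; have b0' := ltW b0.
pose c := b ^+ 2 - 4^-1; pose A := 1 + `|c|.
have A1 : 1 <= A by rewrite lerDl.
have A0 : 0 < A by exact: lt_le_trans A1.
have [C1 C10 g1] := gbinom_growth b0'.
have [C2 C20 g2] : exists2 C : R, 0 < C & forall n, (0 < n)%N ->
    gbinom (n%:R + (b + 1)) n <= C * n%:R `^ (b + 1).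
  by apply: gbinom_growth; rewrite addr_ge0.
pose c1 := C1 * expR (A ^+ 2); pose c2 := C2 * expR (A ^+ 2).
have c10 : 0 < c1 by rewrite mulr_gt0 ?expR_gt0.
have c20 : 0 < c2 by rewrite mulr_gt0 ?expR_gt0.
pose c3 := (A + (b + 2^-1)) * c1 + 2 * A * c2.
have c30 : 0 < c3.
  apply: addr_gt0; apply: mulr_gt0 => //; first by apply: addr_gt0 => //; lra.
  by rewrite mulr_gt0.
pose K0 := 3 * expR 4 * ((A `^ (b + 2^-1)) ^+ 2 * (3 * c1 ^+ 2 + c3 ^+ 2)).
have K00 : 0 <= K0.
  apply: mulr_ge0; first by rewrite mulr_ge0 ?expR_ge0.
  apply: mulr_ge0; first exact: sqr_ge0.
  by apply: addr_ge0; [apply: mulr_ge0 => //|]; exact: sqr_ge0.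
pose K := 1 + (b + 1) / 2.
pose KK := K `^ `|b / 2 - 4^-1|.
pose C3 := c1 * A `^ (b + 2^-1) + 8 * Num.sqrt K0.
have C30 : 0 < C3.
  by apply: ltr_pwDl; [rewrite mulr_gt0 ?powR_gt0|rewrite mulr_ge0 ?sqrtr_ge0].
have K_gt0 : 0 < K by rewrite /K; lra.
exists (C3 * KK), (2 + Num.bound (4 + 3 * `|c|))%N; split.
  by rewrite mulr_gt0 ?powR_gt0.
move=> n nn0.
have n2 : (2 <= n)%N by apply: leq_trans nn0; rewrite leq_addr.
have n1 : (0 < n)%N by exact: leq_trans n2.
have nR : 1 <= n%:R :> R by rewrite ler1n.
have nbig : 4 + 3 * `|c| <= n%:R.
  apply: (@le_trans _ _ (Num.bound (4 + 3 * `|c|))%:R).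
    by apply/ltW/archi_boundP; rewrite addr_ge0// mulr_ge0.
  by rewrite ler_nat (leq_trans _ nn0)// leq_addl.
pose M := Num.sqrt (n%:R + (b + 1) / 2).
have MM : M ^+ 2 = n%:R + (b + 1) / 2 by rewrite sqr_sqrtr//; lra.
have nM : n%:R <= M ^+ 2 by rewrite MM; lra.
have MK : M ^+ 2 <= K * n%:R.
  have h0 : 0 <= (b + 1) / 2 by lra.
  have := ler_wpM2l h0 nR; rewrite MM /K; lra.
have cge0 : 0 <= `|c| := normr_ge0 c.
have M2 : 2 <= M by rewrite -ler_sqr ?nnegrE ?sqrtr_ge0//; lra.
have M0 : 0 < M by lra.
have MN0 : M != 0 by rewrite gt_eqF.
pose P := M `^ b.
have P0 : 0 < P by exact: powR_gt0.
have P1 : 1 <= P.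
  by rewrite -[leLHS](powRr0 M) ler_powR//; lra.
have PE s : 0 <= s -> n%:R `^ s <= (M `^ s) ^+ 2.
  move=> s0; rewrite -powR_mulrn ?powR_ge0// -powRrM mulrC powRrM.
  rewrite powR_mulrn ?(ltW M0)//; apply: (ge0_ler_powR s0 _ _ nM).
    by rewrite nnegrE ler0n.
  by rewrite nnegrE sqr_ge0.
have e_le (x : R) : 0 <= x -> expR (- x / 2) <= 1.
  by move=> x0; rewrite -[leRHS]expR0 ler_expR; lra.
pose L := laguerre b n.
(* with P = M^b, the bounds of L_n and L_n' on the first interval are of order P^2
   and (P M)^2 *)
have Lsmall (x : R) : 0 <= x -> n%:R * x <= A ^+ 2 -> `|L.[x]| <= c1 * P ^+ 2.
  move=> x0 nx; apply: le_trans (normr_laguerre_le n b0' x0) _.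
  rewrite /c1 [leRHS]mulrAC; apply: ler_pM; rewrite ?expR_ge0 ?gbinom_top_ge0//.
    by apply: le_trans (g1 n n1) _; rewrite ler_wpM2l ?(ltW C10)// PE.
  by rewrite ler_expR.
have L1small (x : R) : 0 <= x -> n%:R * x <= A ^+ 2 ->
    `|L^`().[x]| <= c2 * (P * M) ^+ 2.
  move=> x0 nx; have [m mE] : exists m, n = m.+1 by exists n.-1; rewrite prednK.
  have m0 : (0 < m)%N by move: n2; rewrite mE.
  have mn : m%:R <= n%:R :> R by rewrite ler_nat mE.
  rewrite /L mE deriv_laguerre hornerN normrN.
  apply: le_trans (normr_laguerre_le m _ x0) _; first by rewrite addr_ge0.
  rewrite /c2 [leRHS]mulrAC; apply: ler_pM; rewrite ?expR_ge0 ?gbinom_top_ge0 ?addr_ge0//.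
    apply: le_trans (g2 m m0) _; rewrite ler_wpM2l ?(ltW C20)//.
    have -> : P * M = M `^ (b + 1) by rewrite powRDp// powRr1// ltW.
    apply: le_trans (PE _ _); last by rewrite addr_ge0.
    by apply: ge0_ler_powR => //; rewrite ?nnegrE// addr_ge0.
  by rewrite ler_expR; apply: le_trans nx; rewrite ler_wpM2r.
pose E (r : R) := expR (- (r * r) / 2) * r `^ (b + 2^-1).
pose u r := E r * L.[r * r].
pose u1 r := E r * ((- r + (b + 2^-1) / r) * L.[r * r] + 2 * r * L^`().[r * r]).
pose t1 := A / M.
have t10 : 0 < t1 by rewrite divr_gt0.
have t1A : t1 <= A * M.
  rewrite ler_pM2l// (@le_trans _ _ 1) ?invf_le1//; clear -M2; lra.
have nt1 (t : R) : 0 <= t -> t <= t1 -> n%:R * (t * t) <= A ^+ 2.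
  move=> t0 tt1; apply: (@le_trans _ _ (M ^+ 2 * (t1 * t1))).
    by apply: ler_pM => //; [exact: mulr_ge0|exact: ler_pM].
  by rewrite /t1 le_eqVlt; apply/orP; left; apply/eqP; field.
have t1t1 := nt1 _ (ltW t10) (lexx _).
pose Q := t1 `^ (b + 2^-1).
have Q0 : 0 <= Q by exact: powR_ge0.
have MhE : (M `^ (b + 2^-1)) ^+ 2 = P ^+ 2 * M.
  rewrite powRDp// exprMn -/P; congr (_ * _).
  by rewrite powR12_sqrt ?(ltW M0)// sqr_sqrtr// ltW.
have QE : Q ^+ 2 * (P ^+ 2 * M) = (A `^ (b + 2^-1)) ^+ 2.
  rewrite -MhE -exprMn -powRM ?(ltW t10) ?(ltW M0)//.
  by rewrite /t1 divfK.
have Et1 : 0 <= E t1 <= Q.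
  by rewrite mulr_ge0 ?expR_ge0//= /E ler_piMl// e_le// mulr_ge0// ltW.
have ut1 : `|u t1| <= Q * (c1 * P ^+ 2).
  case/andP: Et1 => E1 E2; rewrite normrM (ger0_norm E1).
  by apply: ler_pM => //; rewrite Lsmall// mulr_ge0// ltW.
have u1t1 : `|u1 t1| <= Q * (c3 * P ^+ 2 * M).
  case/andP: Et1 => E1 E2; rewrite normrM (ger0_norm E1).
  apply: ler_pM => //; apply: le_trans (ler_normD _ _) _.
  rewrite normrM [`|2 * t1 * _|]normrM [`|2 * t1|]normrM.
  have L1 := Lsmall _ (mulr_ge0 (ltW t10) (ltW t10)) t1t1.
  have L2 := L1small _ (mulr_ge0 (ltW t10) (ltW t10)) t1t1.
  have h1 : `|- t1 + (b + 2^-1) / t1| <= (A + (b + 2^-1)) * M.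
    apply: le_trans (ler_normD _ _) _; rewrite normrN (gtr0_norm t10) [leRHS]mulrDl.
    apply: lerD => //; rewrite ger0_norm; last by rewrite divr_ge0 ?(ltW t10)//; clear -b0; lra.
    rewrite ler_wpM2l//; first by clear -b0; lra.
    by rewrite /t1 invf_div ler_pdivrMr// ler_peMr// ltW.
  have h2 : `|2%:R| * `|t1| * `|L^`().[t1 * t1]| <= 2 * (A / M) * (c2 * (P * M) ^+ 2).
    rewrite (gtr0_norm t10) normr_nat; apply: ler_wpM2l L2.
    by rewrite mulr_ge0// ltW.
  have h3 := ler_pM (normr_ge0 _) (normr_ge0 _) h1 L1.
  apply: le_trans (lerD h3 h2) _; rewrite /c3 le_eqVlt; apply/orP; left; apply/eqP.
  by field.
pose B := 3 * expR 4 * (3 * M * u t1 ^+ 2 + u1 t1 ^+ 2 / M).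
have BK : B <= K0 * P ^+ 2.
  have k1 : u t1 ^+ 2 <= (Q * (c1 * P ^+ 2)) ^+ 2.
    by rewrite -(real_normK (num_real (u t1))) lerXn2r ?nnegrE// (le_trans _ ut1).
  have k2 : u1 t1 ^+ 2 <= (Q * (c3 * P ^+ 2 * M)) ^+ 2.
    by rewrite -(real_normK (num_real (u1 t1))) lerXn2r ?nnegrE// (le_trans _ u1t1).
  have k3 : 3 * M * u t1 ^+ 2 <= 3 * M * (Q * (c1 * P ^+ 2)) ^+ 2.
    by rewrite ler_wpM2l// mulr_ge0// ltW.
  have k4 : u1 t1 ^+ 2 / M <= (Q * (c3 * P ^+ 2 * M)) ^+ 2 / M.
    by rewrite ler_wpM2r// invr_ge0 ltW.
  have k5 : 3 * M * (Q * (c1 * P ^+ 2)) ^+ 2 + (Q * (c3 * P ^+ 2 * M)) ^+ 2 / M =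
      (A `^ (b + 2^-1)) ^+ 2 * (3 * c1 ^+ 2 + c3 ^+ 2) * P ^+ 2.
    by rewrite -QE; field.
  have k6 := lerD k3 k4; rewrite k5 in k6.
  rewrite /B /K0 -[leRHS]mulrA; apply: ler_wpM2l => //.
have B0 : 0 <= B.
  apply: mulr_ge0; first by rewrite mulr_ge0 ?expR_ge0.
  apply: addr_ge0; first by rewrite mulr_ge0 ?sqr_ge0// mulr_ge0// ltW.
  by rewrite divr_ge0 ?sqr_ge0 ?(ltW M0).
have sB : Num.sqrt B <= Num.sqrt K0 * P.
  apply: (@le_trans _ _ (Num.sqrt (K0 * P ^+ 2))).
    by rewrite ler_sqrt// mulr_ge0 ?sqr_ge0.
  by rewrite sqrtrM// sqrtr_sqr gtr0_norm.
have e8 : 0 < 8^-1 :> R by rewrite invr_gt0.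
have [CL CL0 LC] := horner_le_expR L e8.
have [Cp Cp0 pC] := powR_le_expR (b + 2^-1) e8 ltr01.
(* any bound will do: it only excludes growth beyond the turning point *)
have uC (t : R) : 1 <= t -> `|u t| <= Cp * CL.
  move=> t1'; have t0 : 0 < t by exact: lt_le_trans ltr01 t1'.
  have tt : t <= t * t by rewrite ler_peMr// ltW.
  have tt0 : 0 <= t * t by rewrite mulr_ge0// ltW.
  rewrite /u normrM ger0_norm; last by rewrite mulr_ge0 ?expR_ge0 ?powR_ge0.
  apply: le_trans (ler_wpM2l _ (LC _ tt0)) _.
    by rewrite mulr_ge0 ?expR_ge0 ?powR_ge0.
  apply: (@le_trans _ _ (expR (- (t * t) / 2) * (Cp * expR (8^-1 * t)) *
      (CL * expR (8^-1 * (t * t))))).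
    rewrite ler_wpM2r ?mulr_ge0 ?expR_ge0// ler_wpM2l ?expR_ge0//.
    exact: pC.
  have -> : expR (- (t * t) / 2) * (Cp * expR (8^-1 * t)) *
      (CL * expR (8^-1 * (t * t))) = Cp * CL *
      expR (- (t * t) / 2 + 8^-1 * t + 8^-1 * (t * t)) by rewrite !expRD; ring.
  rewrite ler_piMr ?mulr_ge0 ?(ltW Cp0)// -[leRHS]expR0 ler_expR.
  by clear -tt tt0; lra.
have du (t : R) : 0 < t -> is_derive t 1 u (u1 t).
  by move=> t0; have [] := laguerre_liouville b n t0.
have du1 (t : R) : 0 < t -> is_derive t 1 u1
    (- ((4 * M ^+ 2 - t ^+ 2 - c * t^-1 ^+ 2) * u t)).
  by move=> t0; rewrite MM; have [] := laguerre_liouville b n t0.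
have cM : 3 * `|c| + 1 <= M ^+ 2 by clear -nbig nM; lra.
have [z1 z2] := model_oscillator_bound M2 cM du du1 uC.
pose m := M `^ (- 2^-1).
have m0 : 0 < m by exact: powR_gt0.
pose q := b + 2^-1.
have q0 : 0 <= q by rewrite /q; clear -b0; lra.
have MqE : M `^ q = P / m.
  by rewrite /q powRDp// -/P /m powRN invrK.
have powN (s t : R) : 0 < s -> s <= t -> t `^ (- q) <= s `^ (- q).
  move=> s0 st; have t0 := lt_le_trans s0 st.
  rewrite !powRN lef_pV2 ?posrE ?powR_gt0//.
  by apply: ge0_ler_powR => //; rewrite nnegrE ltW.
have uE (t : R) : 0 < t ->
    expR (- (t * t) / 2) * `|L.[t * t]| = `|u t| * t `^ (- q).
  move=> t0; rewrite /u normrM ger0_norm; last by rewrite mulr_ge0 ?expR_ge0 ?powR_ge0.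
  rewrite /E -/q powRN; field.
  by rewrite gt_eqF// powR_gt0.
have main (t : R) : 0 < t -> expR (- (t * t) / 2) * `|L.[t * t]| <=
    C3 * (P * m) * (1 + t `^ (- q)).
  move=> t0; have tq0 : 0 <= t `^ (- q) by exact: powR_ge0.
  have sK := sqrtr_ge0 K0.
  have Aq0 : 0 <= A `^ q by exact: powR_ge0.
  have Pm0 : 0 < P * m by rewrite mulr_gt0.
  have [tt1|t1t] := leP t t1.
    apply: (@le_trans _ _ (c1 * P ^+ 2)).
      apply: (@le_trans _ _ (1 * (c1 * P ^+ 2))); last by rewrite mul1r.
      have tt0 : 0 <= t * t by rewrite mulr_ge0// ltW.
      apply: ler_pM; rewrite ?expR_ge0//; first exact: e_le.
      by apply: Lsmall => //; apply: nt1 => //; exact: ltW.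
    apply: (@le_trans _ _ (c1 * A `^ q * (P * m) * t1 `^ (- q))).
      have QA : A `^ q = Q * (P / m).
        rewrite -MqE -powRM ?(ltW t10) ?(ltW M0)//.
        by rewrite /t1 divfK.
      have QN0 : Q != 0 by rewrite gt_eqF// powR_gt0.
      rewrite QA powRN -/Q le_eqVlt; apply/orP; left; apply/eqP; field.
      by rewrite QN0 gt_eqF.
    apply: ler_pM; [|exact: powR_ge0| |].
    - by rewrite mulr_ge0 ?(ltW Pm0)// mulr_ge0// ltW.
    - by rewrite ler_wpM2r ?(ltW Pm0)// /C3 -/q lerDl mulr_ge0.
    - by apply: (@le_trans _ _ (t `^ (- q))); [exact: powN|rewrite lerDr].
  have C3le : 8 * Num.sqrt K0 <= C3.
    by rewrite /C3 lerDr mulr_ge0// ltW.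
  rewrite uE//; have [tM|/ltW Mt] := leP t M.
    have ule : `|u t| <= Num.sqrt K0 * (P * m).
      rewrite -ler_sqr; last 2 first.
      - by rewrite nnegrE.
      - by rewrite nnegrE mulr_ge0// ltW.
      rewrite (real_normK (num_real (u t))).
      rewrite [(_ * (P * m)) ^+ 2]exprMn sqr_sqrtr// [(P * m) ^+ 2]exprMn.
      have -> : m ^+ 2 = M^-1.
        rewrite -powR_mulrn ?(ltW m0)// -powRrM mulNr mulVf// powR_inv1//.
        exact: ltW.
      rewrite mulrA ler_pdivlMr// mulrC; apply: le_trans BK.
      by apply: z1; rewrite (ltW t1t).
    apply: ler_pM => //; last by rewrite lerDr.
    apply: le_trans ule _; rewrite ler_wpM2r ?(ltW Pm0)//.
    by clear -C3le sK; lra.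
  have ule : `|u t| <= 8 * Num.sqrt K0 * P.
    by apply: le_trans (z2 t Mt) _; rewrite -[leRHS]mulrA; apply: ler_wpM2l.
  apply: (@le_trans _ _ (8 * Num.sqrt K0 * P * (M `^ (- q)))).
    by apply: ler_pM => //; exact: powN.
  rewrite powRN MqE invf_div.
  have -> : 8 * Num.sqrt K0 * P * (m / P) = 8 * Num.sqrt K0 * m.
    by field; rewrite gt_eqF.
  apply: (@le_trans _ _ (C3 * (P * m))); last first.
    by apply: ler_peMr; [rewrite mulr_ge0 ?(ltW C30) ?(ltW Pm0)|rewrite lerDl powR_ge0].
  apply: ler_pM; [exact: mulr_ge0|exact: ltW|exact: C3le|].
  by apply: ler_peMl => //; exact: ltW.
move=> x x0; pose t := Num.sqrt x.
have t0 : 0 < t by rewrite sqrtr_gt0.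
have ttx : t * t = x by rewrite -expr2 sqr_sqrtr// ltW.
have tx : t `^ (- q) = x `^ (- (b / 2 + 4^-1)).
  rewrite /t -powR12_sqrt ?(ltW x0)// -powRrM; congr (_ `^ _).
  by rewrite /q; field.
have := main t t0; rewrite ttx tx => /le_trans; apply.
rewrite ler_wpM2r ?addr_ge0 ?powR_ge0// -mulrA ler_wpM2l ?(ltW C30)//.
have -> : P * m = (M ^+ 2) `^ (b / 2 - 4^-1).
  rewrite /P /m -powRDp// -powR_mulrn ?(ltW M0)// -powRrM; congr (_ `^ _).
  by field.
apply: powR_comparable => //; [by rewrite exprn_gt0|by rewrite ltr0n|].
by rewrite (le_trans nM)// ler_peMl ?sqr_ge0// /K; clear -b0; lra.
Qed.

End laguerre_bound.

(** * Weighted powers with logarithms, and the Gamma function *)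

Section log_moments.
Context {R : realType}.
Notation mu := (@lebesgue_measure R).
Notation D := (`]0%R, +oo[%classic : set R).
Implicit Types (s e : R) (m : nat) (p : {poly R}).

Definition log_moment_fun s m p (x : R) : R :=
  x `^ s * ln x ^+ m * p.[x] * expR (- x).

Lemma log_moment_fun_bound s m p e : 0 < e -> exists2 C : R, 0 <= C &
  forall x, 0 < x -> `|log_moment_fun s m p x| <=
    C * ((x `^ (s + e) + x `^ (s - e)) * expR (- 2^-1 * x)).
Proof.
move=> e0; have [C1 C10 lnC] := normr_lnX_le m e0.
have h0 : 0 < 2^-1 :> R by rewrite invr_gt0.
have [C2 C20 pC] := horner_le_expR p h0.
exists (C1 * C2); first by rewrite mulr_ge0// ltW.
move=> x x0; rewrite /log_moment_fun !normrM !(ger0_norm (expR_ge0 _)).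
rewrite (ger0_norm (powR_ge0 _ _)) normrX.
apply: (@le_trans _ _ (x `^ s * (C1 * (x `^ e + x `^ (- e))) *
    (C2 * expR (2^-1 * x)) * expR (- x))).
  rewrite ler_wpM2r ?expR_ge0//; apply: ler_pM => //.
  - by rewrite mulr_ge0 ?powR_ge0 ?exprn_ge0.
  - by rewrite ler_wpM2l ?powR_ge0// lnC.
  - by rewrite pC// ltW.
rewrite !(powRDp _ _ x0) (_ : - 2^-1 * x = 2^-1 * x + - x); last by field.
rewrite expRD le_eqVlt; apply/orP; left; apply/eqP; ring.
Qed.

Lemma derR_lnX m (x : R) : 0 < x ->
  is_derive x 1 (fun y : R => ln y ^+ m) (m%:R * ln x ^+ m.-1 * x^-1).
Proof.
move=> x0; have dl := derR_ln x0.
elim: m => [|m IH]; first by apply: derR_eq (derR_cst x 1) _; rewrite !mul0r.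
have -> : (fun y : R => ln y ^+ m.+1) = (fun y => ln y * ln y ^+ m).
  by apply/funext => y; rewrite exprS.
apply: derR_eq (derR_mul dl IH) _.
case: m {IH} => [|m] /=; first by rewrite expr0; ring.
by rewrite exprS; ring.
Qed.

Lemma log_moment_fun_derivable s m p (x : R) : 0 < x ->
  exists a, is_derive x 1 (log_moment_fun s m p) a.
Proof.
move=> x0.
have dl := derR_lnX m x0.
have de := derR_expR (derR_opp (derR_id x)).
eexists; exact: derR_mul (derR_mul (derR_mul (derR_powR s (derR_id x) x0) dl)
  (derR_poly p (derR_id x))) de.
Qed.

Lemma log_moment_fun_continuous s m p (x : R) : 0 < x ->
  {for x, continuous (log_moment_fun s m p)}.
Proof.
by move=> x0; have [a /derive_continuous] := log_moment_fun_derivable s m p x0.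
Qed.

Lemma integrable_log_moment_fun s m p : -1 < s ->
  mu.-integrable D (EFin \o log_moment_fun s m p).
Proof.
move=> s1; pose e := (s + 1) / 2.
have e0 : 0 < e by rewrite /e; lra.
have [C C0 HC] := log_moment_fun_bound s m p e0.
apply: (@integrable_half_line_le _ _ (fun x => C *
    ((x `^ (s + e) + x `^ (s - e)) * expR (- 2^-1 * x)))) => //.
  by move=> x; exact: log_moment_fun_continuous.
apply: integrable_half_lineZ.
have -> : (fun x : R => (x `^ (s + e) + x `^ (s - e)) * expR (- 2^-1 * x)) =
    (fun x => x `^ (s + e) * expR (- 2^-1 * x) + x `^ (s - e) * expR (- 2^-1 * x)).
  by apply/funext => x; rewrite mulrDl.
apply: integrable_half_lineD; apply: integrable_powR_expR; rewrite /e; lra.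
Qed.

Lemma log_moment_fun_cvg0 s m p : 0 < s ->
  log_moment_fun s m p x @[x --> 0^'+] --> (0 : R).
Proof.
move=> s0; have e0 : 0 < s / 2 by lra.
have [C C0 HC] := log_moment_fun_bound s m p e0.
apply: (@cvg0_at_right _ _ (C * 2) (s / 2)) => // x /andP[x0 x1].
apply: le_trans (HC x x0) _; rewrite -mulrA; apply: ler_wpM2l => //.
have -> : s - s / 2 = s / 2 by field.
apply: (@le_trans _ _ ((x `^ (s / 2) + x `^ (s / 2)) * 1)); last first.
  by rewrite mulr1 mulr_natl mulr2n.
apply: ler_pM; rewrite ?addr_ge0 ?powR_ge0 ?expR_ge0//.
  by rewrite lerD2r; apply: ger_powR; rewrite ?x0//; lra.
by rewrite -[leRHS]expR0 ler_expR; lra.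
Qed.

Lemma log_moment_fun_cvgy s m p :
  log_moment_fun s m p x @[x --> +oo] --> (0 : R).
Proof.
have [C C0 HC] := log_moment_fun_bound s m p ltr01.
have h0 : 0 < 2^-1 :> R by rewrite invr_gt0.
have [C1 C10 H1] := powR_le_expR (s + 1 + 1) h0 ltr01.
have [C2 C20 H2] := powR_le_expR (s - 1 + 1) h0 ltr01.
apply: (@cvg0_pinfty _ _ (C * (C1 + C2)) 1) => x x1.
have x0 : 0 < x by lra.
apply: le_trans (HC x x0) _; rewrite -mulrA; apply: ler_wpM2l => //.
have := H1 x x1; have := H2 x x1; rewrite !(powRDp _ 1 x0) powRr1 ?(ltW x0)// => h2 h1.
rewrite mulNr expRN ler_pdivrMr ?expR_gt0// mulrAC ler_pdivlMr//; lra.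
Qed.

Lemma weighted_laguerre_derive (b : R) n (x : R) : 0 < x ->
  is_derive x 1
    (fun y : R => y `^ (b + 1) * expR (- y) * (laguerre (b + 1) n).[y])
    (n.+1%:R * (x `^ b * expR (- x) * (laguerre b n.+1).[x])).
Proof.
move=> x0; have de := derR_expR (derR_opp (derR_id x)).
apply: derR_eq (derR_mul (derR_mul (derR_powR (b + 1) (derR_id x) x0) de)
  (derR_poly (laguerre (b + 1) n) (derR_id x))) _.
rewrite addrK (powRDp b 1 x0) powRr1 ?(ltW x0)//.
have -> : n.+1%:R * (x `^ b * expR (- x) * (laguerre b n.+1).[x]) =
    x `^ b * expR (- x) * (n.+1%:R * (laguerre b n.+1).[x]) by ring.
by rewrite -laguerre_raise; ring.
Qed.

End log_moments.

Section gamma.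
Context {R : realType}.
Notation mu := (@lebesgue_measure R).
Notation D := (`]0%R, +oo[%classic : set R).

Let GammaE (s : R) : Gamma s = \int[mu]_(x in D) log_moment_fun (s - 1) 0 1 x.
Proof.
rewrite /Gamma; congr (Rintegral _ _ _); apply/funext => x.
by rewrite /log_moment_fun expr0 hornerC !mulr1.
Qed.

Lemma GammaS (s : R) : 0 < s -> Gamma (s + 1) = s * Gamma s.
Proof.
move=> s0; rewrite !GammaE addrK.
have s1 : -1 < s - 1 by lra.
have s2 : -1 < s by lra.
have i1 := integrable_log_moment_fun 0 1 s1.
have i2 := integrable_log_moment_fun 0 1 s2.
have WE r (x : R) : log_moment_fun r 0 1 x = x `^ r * expR (- x).
  by rewrite /log_moment_fun expr0 hornerC !mulr1.
have dH (x : R) : 0 < x -> is_derive x 1 (log_moment_fun s 0 1)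
    (s * log_moment_fun (s - 1) 0 1 x + - 1 * log_moment_fun s 0 1 x).
  move=> x0; rewrite (funext (WE s)) !WE.
  apply: derR_eq (derR_mul (derR_powR s (derR_id x) x0)
    (derR_expR (derR_opp (derR_id x)))) _; ring.
have cW c r (x : R) : 0 < x -> {for x, continuous (fun y => c * log_moment_fun r 0 1 y)}.
  move=> x0; apply: continuousM; first exact: cst_continuous.
  exact: log_moment_fun_continuous.
have := Rintegral_by_parts dH (@cW s _) (@cW (-1) _) (integrable_half_lineZ s i1)
  (integrable_half_lineZ (-1) i2) (log_moment_fun_cvg0 0 1 s0)
  (log_moment_fun_cvgy s 0 1).
do 2 (rewrite RintegralZl; [|exact: measurable_itv|by []]).
by move=> ->; ring.
Qed.

Lemma Gamma_gt0 (s : R) : 0 < s -> 0 < Gamma s.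
Proof.
move=> s0; rewrite GammaE.
have s1 : -1 < s - 1 by lra.
have i1 := integrable_log_moment_fun 0 1 s1.
have [mf _] := integrableP _ _ _ i1.
set f := log_moment_fun _ _ _ in i1 mf *.
have f0 (x : R) : 0 <= f x.
  by rewrite /f /log_moment_fun expr0 hornerC !mulr1 mulr_ge0 ?powR_ge0 ?expR_ge0.
pose c : R := expR (- `|s - 1| * ln 2) * expR (- 2).
have c0 : 0 < c by rewrite mulr_gt0 ?expR_gt0.
have fc (x : R) : 1 <= x <= 2 -> c <= f x.
  move=> /andP[x1 x2]; have x0 : 0 < x by lra.
  rewrite /f /log_moment_fun expr0 hornerC !mulr1 powRE//.
  apply: ler_pM; rewrite ?expR_ge0// ler_expR; last by lra.
  have l0 : 0 <= ln x by exact: ln_ge0.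
  have l2 : ln x <= ln 2 by rewrite ler_ln ?posrE.
  have := ler_norm (- (s - 1)); rewrite normrN => h.
  have := normr_ge0 (s - 1); nra.
suff : (c%:E <= \int[mu]_(x in D) (f x)%:E)%E.
  move=> h; rewrite /Rintegral fine_gt0//; apply/andP; split.
    by apply: lt_le_trans h; rewrite lte_fin.
  have : (\int[mu]_(x in D) (f x)%:E)%E \is a fin_num.
    by apply: integrable_fin_num i1; exact: measurable_itv.
  by rewrite fin_numElt => /andP[].
apply: (@le_trans _ _ (\int[mu]_(x in `[1%R, 2%R]%classic) (f x)%:E)%E); last first.
  apply: ge0_subset_integral => //.
  - by move=> x _; rewrite lee_fin.
  - by move=> x /=; rewrite !in_itv/= andbT => /andP[+ _]; exact: lt_le_trans.
apply: (@le_trans _ _ (\int[mu]_(x in `[1%R, 2%R]%classic) (cst c%:E) x)%E).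
  rewrite integral_cst//= lebesgue_measure_itv/= lte_fin ltr1n.
  by rewrite -EFinB -EFinM lee_fin ler_peMr ?(ltW c0)//; lra.
apply: ge0_le_integral => //.
- by move=> x _; rewrite lee_fin ltW.
- apply: measurable_funS mf => // x /=; rewrite !in_itv/= andbT => /andP[+ _].
  exact: lt_le_trans.
Qed.

(** The functional equation of [Gamma] makes [1 / sigma_n] a product with factors
    [1 - a / n + O(1 / n^2)]. *)
Lemma laguerre_sigma_inv_growth (a : R) : -1 < a -> exists2 C : R, 0 < C &
  forall n, (0 < n)%N -> `|(laguerre_sigma a n)^-1| <= C * n%:R `^ (- a).
Proof.
move=> a1.
have pos n : 0 < n%:R + a + 1 :> R.
  by have : 0 <= n%:R :> R by []; lra.
have fct n : 0 < n`!%:R :> R by rewrite ltr0n fact_gt0.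
have sig0 n : 0 < laguerre_sigma a n.
  by rewrite /laguerre_sigma divr_gt0 ?Gamma_gt0.
have sigS n : (laguerre_sigma a n.+1)^-1 =
    (n%:R + 1) / (n%:R + a + 1) * (laguerre_sigma a n)^-1.
  rewrite /laguerre_sigma (_ : n.+1%:R + a + 1 = n%:R + a + 1 + 1); last first.
    by rewrite -natr1; ring.
  rewrite GammaS// factS natrM -natr1; field.
  apply/and4P; split; apply: lt0r_neq0 => //; first exact: Gamma_gt0.
have [||n n0|C C0 HC] := @product_growth _ (- a) (`|a| * (1 + a))
    (fun n => (laguerre_sigma a n)^-1) 1 isT.
- by rewrite mulr_ge0//; lra.
- by move=> n _; rewrite invr_ge0 ltW.
- rewrite sigS ler_wpM2r ?invr_ge0 ?(ltW (sig0 n))//.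
  have nR : 1 <= n%:R :> R by rewrite ler1n.
  rewrite -subr_ge0.
  have nN0 : n%:R != 0 :> R by rewrite gt_eqF//; lra.
  have -> : 1 + - a / n%:R + `|a| * (1 + a) / n%:R ^+ 2 -
    (n%:R + 1) / (n%:R + a + 1) = (1 + a) * (n%:R * (`|a| - a) + `|a| * (1 + a)) /
      (n%:R ^+ 2 * (n%:R + a + 1)) by field; rewrite nN0 gt_eqF.
  rewrite divr_ge0 ?mulr_ge0 ?sqr_ge0 ?(ltW (pos n))//; first by lra.
  rewrite addr_ge0 ?mulr_ge0 ?subr_ge0 ?ler_norm//; lra.
- by exists C => // n n0; rewrite gtr0_norm ?invr_gt0// HC.
Qed.

End gamma.

(** * Laguerre moments of powers times logarithms *)

Section log_laguerre_moments.
Context {R : realType}.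
Notation mu := (@lebesgue_measure R).
Notation D := (`]0%R, +oo[%classic : set R).
Variables (a d : R).
Hypothesis ad1 : -1 < a + d.

Let I n m := \int[mu]_(x in D) log_moment_fun (a + d) m (laguerre a n) x.
Let K n m := \int[mu]_(x in D) log_moment_fun (a + d) m (laguerre (a + 1) n) x.

Let iW m p : mu.-integrable D (EFin \o log_moment_fun (a + d) m p).
Proof. exact: integrable_log_moment_fun. Qed.

(** Integration by parts against
    [(x^(a+1) e^(-x) L_n^(a+1))' = (n+1) x^a e^(-x) L_(n+1)^a]. *)
Let by_parts n m : n.+1%:R * I n.+1 m = - (d * K n m + m%:R * K n m.-1).
Proof.
have dH (x : R) : 0 < x ->
    is_derive x 1 (log_moment_fun (a + d + 1) m (laguerre (a + 1) n))
    (n.+1%:R * log_moment_fun (a + d) m (laguerre a n.+1) x +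
    (d * log_moment_fun (a + d) m (laguerre (a + 1) n) x +
     m%:R * log_moment_fun (a + d) m.-1 (laguerre (a + 1) n) x)).
  move=> x0; have := derR_mul (derR_mul (derR_powR d (derR_id x) x0)
    (derR_lnX m x0)) (weighted_laguerre_derive a n x0) => dF.
  apply: (@derR_ext _ (fun y : R => y `^ d * ln y ^+ m *
      (y `^ (a + 1) * expR (- y) * (laguerre (a + 1) n).[y]))).
    near=> y; have y0 : 0 < y by near: y; exact: lt_nbhsr.
    rewrite /log_moment_fun.
    have -> : a + d + 1 = d + (a + 1) by ring.
    by rewrite (powRDp d _ y0); ring.
  apply: derR_eq dF _; rewrite /log_moment_fun.
  have xN0 : x != 0 by rewrite gt_eqF.
  rewrite !(powRDp _ _ x0) powRN !powRr1 ?(ltW x0)//; by field.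
have cW c r k p (x : R) : 0 < x -> {for x, continuous (fun y => c * log_moment_fun r k p y)}.
  move=> x0; apply: continuousM; first exact: cst_continuous.
  exact: log_moment_fun_continuous.
have iZ c k p : mu.-integrable D (EFin \o (fun x => c * log_moment_fun (a + d) k p x)).
  by apply: integrable_half_lineZ; exact: iW.
have ad0 : 0 < a + d + 1 by rewrite -ltrBlDr sub0r.
have cV (x : R) : 0 < x -> {for x, continuous (fun y =>
    d * log_moment_fun (a + d) m (laguerre (a + 1) n) y +
    m%:R * log_moment_fun (a + d) m.-1 (laguerre (a + 1) n) y)}.
  by move=> x0; apply: continuousD; exact: cW.
have := Rintegral_by_parts dH (@cW _ _ _ _) cV (iZ _ _ _)
  (integrable_half_lineD (iZ _ _ _) (iZ _ _ _))
  (log_moment_fun_cvg0 _ _ ad0) (log_moment_fun_cvgy _ _ _).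
rewrite RintegralZl; [|exact: measurable_itv|exact: iW].
rewrite RintegralD; [|exact: measurable_itv|exact: iZ|exact: iZ].
by rewrite !RintegralZl; [|exact: measurable_itv|exact: iW|exact: measurable_itv|exact: iW].
Unshelve. all: by end_near. Qed.

Let pascal n m : K n.+1 m = I n.+1 m + K n m.
Proof.
rewrite /K /I -RintegralD//; try exact: iW.
apply: eq_Rintegral => x _.
by rewrite laguerre_pascal /log_moment_fun hornerD; ring.
Qed.

(** Subtracting [by_parts] at [n] and [n - 1], the Pascal identity leaves a
    first-order recurrence; a logarithm that is differentiated away produces the
    inhomogeneous term. *)
Lemma log_laguerre_moment_rec n m : (0 < n)%N ->
  n.+1%:R * I n.+1 m = (n%:R - d) * I n m - m%:R * I n m.-1.
Proof.
case: n => [//|n] _; have := by_parts n.+1 m; have := by_parts n m.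
rewrite !pascal; lra.
Qed.

Let l (n : nat) : R := ln (2 * Num.sqrt n%:R).

Let lE n : (0 < n)%N -> l n = ln 2 + ln n%:R / 2.
Proof.
move=> n0; have nR : 0 < n%:R :> R by rewrite ltr0n.
by rewrite /l lnM ?posrE ?sqrtr_gt0// -powR12_sqrt ?(ltW nR)// ln_powR [2^-1 * _]mulrC.
Qed.

Let ln2 : 0 < ln 2 :> R. Proof. by rewrite ln_gt0// ltr1n. Qed.

Let l_bounds n : (0 < n)%N -> [/\ ln 2 <= l n, ln n%:R <= 2 * l n & l n <= l n.+1].
Proof.
move=> n0; rewrite !lE//; have nR : 1 <= n%:R :> R by rewrite ler1n.
have := ln_ge0 nR; have l2 := ln2.
have : ln n%:R <= ln n.+1%:R :> R by rewrite ler_ln ?posrE ?ltr0n// ler_nat.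
by split; lra.
Qed.

(** By induction on [m]: the homogeneous factor [(n - d) / (n + 1)] gives
    [n^(-d-1)], and the inhomogeneous term, smaller by [1 / (n ln n)], adds up to one
    more logarithm. *)
Lemma log_laguerre_moment_growth m : exists (C : R) (n0 : nat), (0 < n0)%N /\
  forall n, (n0 <= n)%N -> `|I n m| <= C * n%:R `^ (- d - 1) * l n ^+ m.
Proof.
pose n1 := (Num.bound `|d|).+1.
have big n : (n1 <= n)%N -> d <= n%:R /\ (0 < n)%N.
  move=> n1n; split; last exact: leq_trans n1n.
  apply: le_trans (ler_norm _) _; apply/ltW; apply: lt_le_trans (archi_boundP _) _ => //.
  by rewrite ler_nat ltnW.
pose c := `|d + 1|.
have ratio n : (n1 <= n)%N ->
    (n%:R - d) / n.+1%:R <= 1 + (- d - 1) / n%:R + c / n%:R ^+ 2.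
  move=> /big[_ n0]; have nR : 0 < n%:R :> R by rewrite ltr0n.
  have n1R : 0 < n%:R + 1 :> R by lra.
  rewrite -subr_ge0 -natr1.
  have -> : 1 + (- d - 1) / n%:R + c / n%:R ^+ 2 - (n%:R - d) / (n%:R + 1) =
    ((c - (d + 1)) * n%:R + c) / (n%:R ^+ 2 * (n%:R + 1)).
    by field; rewrite !lt0r_neq0.
  rewrite divr_ge0 ?mulr_ge0 ?sqr_ge0 ?(ltW n1R)// addr_ge0 ?normr_ge0//.
  by rewrite mulr_ge0 ?(ltW nR)// subr_ge0 ler_norm.
have step k n : (n1 <= n)%N -> `|I n.+1 k| <=
    (1 + (- d - 1) / n%:R + c / n%:R ^+ 2) * `|I n k| + k%:R / n%:R * `|I n k.-1|.
  move=> n1n; have [dn n0] := big _ n1n.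
  have nR : 0 < n%:R :> R by rewrite ltr0n.
  have n1R : 0 < n.+1%:R :> R by rewrite ltr0n.
  have -> : I n.+1 k = (n%:R - d) / n.+1%:R * I n k - k%:R / n.+1%:R * I n k.-1.
    apply: (mulfI (lt0r_neq0 n1R)); rewrite log_laguerre_moment_rec//.
    by field; rewrite nat1r lt0r_neq0.
  apply: le_trans (ler_normB _ _) _; rewrite !normrM; apply: lerD.
    apply: ler_wpM2r => //; apply: le_trans (ratio _ n1n).
    by rewrite !ger0_norm ?invr_ge0 ?subr_ge0// ltW.
  apply: ler_wpM2r => //; rewrite normr_nat; apply: ler_wpM2l => //.
  by rewrite gtr0_norm ?invr_gt0// lef_pV2 ?posrE// ler_nat.
elim: m => [|m [C [n0 [n00 HC]]]].
  have [||n n1n|C C0 HC] := @product_growth R (- d - 1) c (fun n => `|I n 0|) n1 isT.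
  - exact: normr_ge0.
  - by [].
  - by have := step 0%N n n1n; rewrite mul0r mul0r addr0.
  - by exists C, n1; split => // n n1n; rewrite expr0 mulr1 HC.
pose n2 := maxn n0 n1.
have n20 : (0 < n2)%N by rewrite leq_max n00.
have C0 : 0 <= C.
  have := HC n0 (leqnn _); have := normr_ge0 (I n0 m) => /le_trans h /h.
  have [L1 _ _] := l_bounds n00.
  have l0 : 0 < l n0 by exact: lt_le_trans L1.
  by rewrite pmulr_lge0 ?exprn_gt0// pmulr_lge0// powR_gt0// ltr0n.
have n2n n : (n2 <= n)%N -> (n0 <= n)%N /\ (n1 <= n)%N.
  by rewrite geq_max => /andP.
have [||||n n2n'|C1 C10 HC1] := @recurrence_growth R (- d - 1) c (m.+1%:R * C)
    (fun n => `|I n m.+1|) (fun n => l n ^+ m) n2 n20.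
- exact: normr_ge0.
- by rewrite mulr_ge0.
- by [].
- move=> n /n2n[/(leq_trans n00) nn _]; have [L1 _ L2] := l_bounds nn.
  have l0 : 0 <= l n by apply: le_trans L1; exact: ltW.
  by rewrite exprn_ge0//= lerXn2r ?nnegrE// (le_trans l0).
- have [nn0 nn1] := n2n _ n2n'; apply: le_trans (step _ _ nn1) _.
  rewrite lerD2l /=; have nR : 0 < n%:R :> R by rewrite ltr0n (leq_trans n00).
  have := HC _ nn0; rewrite (powRDp _ (-1) nR) powR_inv1 ?(ltW nR)// => h.
  have kn : 0 <= m.+1%:R / n%:R :> R by rewrite divr_ge0// ltW.
  apply: le_trans (ler_wpM2l kn h) _; rewrite le_eqVlt; apply/orP; left.
  by apply/eqP; ring.
exists (C1 * ((ln 2)^-1 ^+ m.+1 + 2)), n2; split => // n n2n'.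
have [nn0 nn1] := n2n _ n2n'; have n_gt0 : (0 < n)%N by exact: leq_trans nn0.
have [L1 L2 _] := l_bounds n_gt0.
have l0 : 0 < l n by exact: lt_le_trans L1.
have key : 1 + l n ^+ m * ln n%:R <= ((ln 2)^-1 ^+ m.+1 + 2) * l n ^+ m.+1.
  rewrite mulrDl; apply: lerD.
    by rewrite -exprMn exprn_ege1// ler_pdivlMl// mulr1.
  have := ler_wpM2l (exprn_ge0 m (ltW l0)) L2; rewrite exprS; lra.
apply: le_trans (HC1 _ n2n') _; move: key; set k := _ + 2 => key.
have -> : C1 * k * n%:R `^ (- d - 1) * l n ^+ m.+1 =
  C1 * n%:R `^ (- d - 1) * (k * l n ^+ m.+1) by ring.
by apply: ler_wpM2l key; rewrite mulr_ge0 ?powR_ge0// ltW.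
Qed.

End log_laguerre_moments.

(** * Sequences of derivatives *)

Section jets.
Context {R : realType}.
Implicit Types (F G : nat -> R -> R) (d : R).

(** Derivatives are carried as explicit sequences, so that those of a product with
    [x^d ln^m x] are formulas that can be bounded term by term. *)
Definition is_jet F := forall i (x : R), 0 < x -> is_derive x 1 (F i) (F i.+1 x).

Lemma derive1n_jet F (f : R -> R) : is_jet F -> (forall x, 0 < x -> f x = F 0%N x) ->
  forall i x, 0 < x -> derive1n i f x = F i x.
Proof.
move=> jF fF; elim=> [|i IH] x x0; first by rewrite derive1n0 fF.
rewrite derive1nS derive1E.
have : is_derive x 1 (derive1n i f) (F i.+1 x).
  apply: derR_ext (jF i x x0); near=> y; apply/esym/IH; near: y; exact: lt_nbhsr.
by case=> _ ->.
Unshelve. all: by end_near. Qed.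

(** The [i]-th derivative of [x^d ln^m x] is [x^(d-i)] times this polynomial in
    [ln x]. *)
Fixpoint log_poly d m i : {poly R} :=
  if i is j.+1 then (d - j%:R) *: log_poly d m j + (log_poly d m j)^`() else 'X^m.

Definition log_jet d m i (x : R) := x `^ (d - i%:R) * (log_poly d m i).[ln x].

Lemma is_jet_log d m : is_jet (log_jet d m).
Proof.
move=> i x x0; apply: derR_eq (derR_mul (derR_powR (d - i%:R) (derR_id x) x0)
  (derR_poly (log_poly d m i) (derR_ln x0))) _.
rewrite /log_jet /= hornerD hornerZ (_ : d - i.+1%:R = d - i%:R + -1); last first.
  by rewrite -natr1; ring.
have xN0 : x != 0 by rewrite gt_eqF.
by rewrite (powRDp _ (-1) x0) powR_inv1 ?(ltW x0)//; ring.
Qed.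

Lemma log_jet0 d m (x : R) : log_jet d m 0 x = x `^ d * ln x ^+ m.
Proof. by rewrite /log_jet /= subr0 hornerXn. Qed.

Lemma log_jet_bound d m i : exists2 C : R, 0 <= C & forall x, 0 < x ->
  `|log_jet d m i x| <= C * (x `^ (d - i%:R + 1) + x `^ (d - i%:R - 1)).
Proof.
suff pb (p : {poly R}) : exists2 C : R, 0 <= C & forall x, 0 < x ->
    `|p.[ln x]| <= C * (x `^ 1 + x `^ (-1)).
  have [C C0 HC] := pb (log_poly d m i); exists C => // x x0.
  rewrite /log_jet normrM (ger0_norm (powR_ge0 _ _)).
  rewrite (powRDp (d - i%:R) 1 x0) (powRDp (d - i%:R) (-1) x0) -mulrDr mulrCA.
  by apply: ler_wpM2l (HC x x0); exact: powR_ge0.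
elim/poly_ind: p => [|p c _].
  by exists 0 => // x _; rewrite horner0 normr0 mul0r.
move: (p * 'X + c%:P) => {c}p.
have lnC (j : nat) : exists C : R, 0 < C /\ forall x : R, 0 < x ->
    `|ln x| ^+ j <= C * (x `^ 1 + x `^ (- 1)).
  by have [C C0 HC] := normr_lnX_le j (ltr01 : 0 < 1 :> R); exists C.
have [C HC] := choice lnC.
exists (\sum_(i < size p) `|p`_i| * C i).
  by apply: sumr_ge0 => j _; rewrite mulr_ge0// ltW//; case: (HC j).
move=> x x0; rewrite horner_coef mulr_suml; apply: le_trans (ler_norm_sum _ _ _) _.
apply: ler_sum => j _; rewrite normrM normrX -mulrA; apply: ler_wpM2l => //.
by case: (HC j) => _; exact.
Qed.

(** The derivatives of a product, by the Leibniz formula. *)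
Definition jet_mul F G i (x : R) :=
  \sum_(j < i.+1) 'C(i, j)%:R * (F j x * G (i - j)%N x).

Lemma derR_sum n (F : nat -> R -> R) (x : R) (a : nat -> R) :
  (forall j, (j < n)%N -> is_derive x 1 (F j) (a j)) ->
  is_derive x 1 (fun y => \sum_(j < n) F j y) (\sum_(j < n) a j).
Proof.
elim: n => [|n IH] dF.
  have -> : (fun y => \sum_(j < 0) F j y) = (fun=> 0).
    by apply/funext => y; rewrite big_ord0.
  by rewrite big_ord0; exact: derR_cst.
have -> : (fun y => \sum_(j < n.+1) F j y) = (fun y => \sum_(j < n) F j y + F n y).
  by apply/funext => y; rewrite big_ord_recr.
rewrite big_ord_recr; apply: derR_add; last exact: dF.
by apply: IH => j jn; apply: dF; exact: leqW.
Qed.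

(** Differentiating term by term gives two sums, which Pascal's rule recombines. *)
Lemma is_jet_mul F G : is_jet F -> is_jet G -> is_jet (jet_mul F G).
Proof.
move=> jF jG i x x0.
pose a j := 'C(i, j)%:R * (F j.+1 x * G (i - j)%N x + F j x * G (i - j).+1 x).
have dS : is_derive x 1 (jet_mul F G i) (\sum_(j < i.+1) a j).
  apply: (@derR_sum i.+1 (fun j y => 'C(i, j)%:R * (F j y * G (i - j)%N y))).
  move=> j ji; apply: derR_scale.
  exact: derR_mul (jF j x x0) (jG _ x x0).
apply: derR_eq dS _; rewrite /jet_mul /a.
have -> : \sum_(j < i.+1) 'C(i, j)%:R * (F j.+1 x * G (i - j)%N x + F j x * G (i - j).+1 x) =
    \sum_(j < i.+1) 'C(i, j)%:R * (F j.+1 x * G (i - j)%N x) +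
    \sum_(j < i.+1) 'C(i, j)%:R * (F j x * G (i - j).+1 x).
  by rewrite -big_split /=; apply: eq_bigr => j _; rewrite mulrDr.
rewrite [RHS]big_ord_recl /= bin0 subn0.
under [in RHS]eq_bigr => j _ do rewrite /bump /= add1n binS natrD subSS mulrDl.
rewrite big_split /= addrA addrC; congr (_ + _).
rewrite big_ord_recl /= bin0 subn0; congr (_ + _).
rewrite [RHS]big_ord_recr /= bin_small// mul0r addr0.
apply: eq_bigr => j _; rewrite /bump /= add1n.
by have ji := ltn_ord j; rewrite -subSn// subSS.
Qed.

Lemma is_jet_poly (p : {poly R}) : is_jet (fun i x => p^`(i).[x]).
Proof.
move=> i x _; apply: derR_eq (derR_poly p^`(i) (derR_id x)) _.
by rewrite -derivnS mulr1.
Qed.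

Lemma is_jet_sub F G : is_jet F -> is_jet G -> is_jet (fun i x => F i x - G i x).
Proof. by move=> jF jG i x x0; apply: derR_sub; [exact: jF|exact: jG]. Qed.

Lemma jet_mulBr F G H i (x : R) :
  jet_mul F (fun i x => G i x - H i x) i x = jet_mul F G i x - jet_mul F H i x.
Proof.
rewrite /jet_mul -sumrB; apply: eq_bigr => j _; ring.
Qed.

End jets.

(** * Taylor remainders of functions smooth up to the endpoint *)

Section smooth.
Context {R : realType}.
Variable (G : nat -> R -> R).
Hypothesis G_diff : forall (j : nat) (x : R), 0 <= x ->
  (fun h : R => h^-1 * (G j (x + h) - G j x))
    @ within [set h : R | 0 <= x + h] (0 : R)^' --> G j.+1 x.

Lemma half_line_jet : is_jet G.
Proof.
move=> j x x0; have q := @G_diff j x (ltW x0).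
have q' : (fun h : R => h^-1 * (G j (x + h) - G j x)) @ (0 : R)^' --> G j.+1 x.
  move=> U UU.
  have qU : \forall h \near (0 : R)^', 0 <= x + h ->
    U (h^-1 * (G j (x + h) - G j x)) := q U UU.
  suff : \forall h \near (0 : R)^', U (h^-1 * (G j (x + h) - G j x)) by [].
  near=> h; apply: (near qU h) => //.
  have : `|h| < x by near: h; exact: dnbhs0_lt.
  by rewrite ltr_norml => /andP[hx _]; rewrite -lerBlDl sub0r ltW.
have E : (fun h : R => h^-1 *: ((G j \o shift x) (h *: 1) - G j x)) =
    (fun h : R => h^-1 * (G j (x + h) - G j x)).
  by apply/funext => h; rewrite /= /GRing.scale /= mulr1 [h + x]addrC.
split; first by rewrite /derivable E; apply/cvg_ex; exists (G j.+1 x).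
by rewrite /derive E; exact: cvg_lim q'.
Unshelve. all: by end_near. Qed.

Lemma half_line_continuous_at0 j : G j x @[x --> 0^'+] --> G j 0.
Proof.
have q := @G_diff j 0 (lexx 0).
have q' : (fun h : R => h^-1 * (G j (0 + h) - G j 0)) @ 0^'+ --> G j.+1 0.
  move=> U UU.
  have qU : \forall h \near (0 : R), h != 0 -> 0 <= 0 + h ->
    U (h^-1 * (G j (0 + h) - G j 0)) := q U UU.
  suff : \forall h \near (0 : R), 0 < h -> U (h^-1 * (G j (0 + h) - G j 0)) by [].
  near=> h => h0; apply: (near qU h) => //; first by rewrite gt_eqF.
  by rewrite add0r ltW.
have h0 : (fun h : R => h * (h^-1 * (G j (0 + h) - G j 0))) @ 0^'+ --> 0 * G j.+1 0.
  by apply: cvgM q'; apply: cvg_at_right_filter; exact: cvg_id.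
rewrite mul0r in h0.
have : (fun h : R => h * (h^-1 * (G j (0 + h) - G j 0)) + G j 0) @ 0^'+ --> 0 + G j 0.
  by apply: cvgD h0 _; exact: cvg_cst.
rewrite add0r; apply: cvg_trans; apply: near_eq_cvg; near=> h.
have hN0 : h != 0 by rewrite gt_eqF.
by rewrite mulrA divff// mul1r add0r subrK.
Unshelve. all: by end_near. Qed.

Let cvg_horner0 (p : {poly R}) : p.[x] @[x --> 0^'+] --> p.[0].
Proof.
apply: cvg_at_right_filter.
exact: derive_continuous (derR_poly p (derR_id 0)).
Qed.

(** By descending induction on [i]: the [J]-th derivative is bounded by compactness,
    and the mean value theorem integrates the bound once per step, all lower
    derivatives of the remainder being 0 at 0. *)
Lemma taylor_remainder J X : 0 < X ->
  let P := \poly_(j < J) (G j 0 / j`!%:R) in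
  forall i, (i <= J)%N -> exists2 M : R, 0 <= M & forall x : R, 0 < x <= X ->
    `|G i x - P^`(i).[x]| <= M * x ^+ (J - i).
Proof.
move=> X0 P i iJ; pose h j (x : R) := G j x - P^`(j).[x].
have jh : is_jet h by apply: is_jet_sub; [exact: half_line_jet|exact: is_jet_poly].
have h0 j : h j x @[x --> 0^'+] --> h j 0.
  by apply: cvgB; [exact: half_line_continuous_at0|exact: cvg_horner0].
have hc j x : 0 < x -> {within `[0, x], continuous (h j)}.
  move=> x0; apply/continuous_within_itvP => //; split => //.
  - by move=> y; rewrite in_itv/= => /andP[y0 _]; exact: derive_continuous (jh j y y0).
  - by apply: cvg_at_left_filter; exact: derive_continuous (jh j x x0).
have hz j : (j < J)%N -> h j 0 = 0.
  move=> jJ; rewrite /h horner_coef0 coef_derivn addn0 ffactnn coef_poly jJ.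
  by rewrite -(mulr_natr (G j 0 / j`!%:R)) divfK ?subrr// pnatr_eq0 -lt0n fact_gt0.
rewrite -(subKn iJ); elim: (J - i)%N (leq_subr i J) => [|k IH] kJ.
  rewrite subn0 subnn.
  have cn : {within `[0, X], continuous (fun x => `|h J x|)}.
    move=> x; apply: continuous_comp; first exact: hc.
    exact: norm_continuous.
  have [c cX HM] := EVT_max (ltW X0) cn.
  exists `|h J c| => // x /andP[x0 xX]; rewrite expr0 mulr1 -/(h J x).
  by apply: HM; rewrite in_itv/= xX ltW.
have [M M0 HM] := IH (ltnW kJ); exists M => // x /andP[x0 xX].
have kJ' : (J - k.+1 < J)%N by rewrite ltn_subrL/= (leq_ltn_trans _ kJ).
have e1 : (J - k.+1).+1 = (J - k)%N by rewrite subnSK.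
have [||y] := @MVT R (h (J - k.+1)%N) (h (J - k)%N) 0 x x0.
- by move=> y; rewrite in_itv/= => /andP[y0 _]; rewrite -e1; exact: jh.
- exact: hc.
rewrite in_itv/= => /andP[y0 yx]; rewrite hz// !subr0 => hE; rewrite -/(h (J - k.+1)%N x) hE.
have := HM y; rewrite y0 (le_trans (ltW yx) xX) => /(_ isT).
rewrite -/(h (J - k)%N y) !subKn ?(ltnW kJ)// => HMy.
rewrite normrM (gtr0_norm x0) exprSr mulrA; apply: ler_wpM2r; first exact: ltW.
apply: le_trans HMy _; apply: ler_wpM2l => //.
by rewrite lerXn2r ?nnegrE// ltW.
Qed.

End smooth.

(** * Functions bounded by powers against the Laguerre weight *)

Section weighted_products.
Context {R : realType}.
Notation mu := (@lebesgue_measure R).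
Notation D := (`]0%R, +oo[%classic : set R).
Implicit Types (F : R -> R) (p : {poly R}).

Lemma sum_bound n (T : Type) (F : nat -> T -> R) (A : T -> Prop) (B : T -> R) :
  (forall j, (j < n)%N -> exists2 C : R, 0 <= C &
    forall x, A x -> `|F j x| <= C * B x) ->
  exists2 C : R, 0 <= C & forall x, A x -> `|\sum_(j < n) F j x| <= C * B x.
Proof.
elim: n => [|n IH] H.
  by exists 0 => // x _; rewrite big_ord0 normr0 mul0r.
have [C1 C10 H1] := IH (fun j jn => H j (leqW jn)).
have [C2 C20 H2] := H n (ltnSn n).
exists (C1 + C2); first exact: addr_ge0.
move=> x Ax; rewrite big_ord_recr /= mulrDl; apply: le_trans (ler_normD _ _) _.
by apply: lerD; [exact: H1|exact: H2].
Qed.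

Lemma weight_continuous (b : R) p (x : R) : 0 < x ->
  {for x, continuous (fun y : R => y `^ b * expR (- y) * p.[y])}.
Proof.
move=> x0; apply: derive_continuous.
exact: derR_mul (derR_mul (derR_powR b (derR_id x) x0)
  (derR_expR (derR_opp (derR_id x)))) (derR_poly p (derR_id x)).
Qed.

Lemma weighted_bound F (b : R) p (e1 e2 C : R) : 0 <= C ->
  (forall x : R, 0 < x -> `|F x| <= C * ((x `^ e1 + x `^ e2) * expR (2^-1 * x))) ->
  exists2 C' : R, 0 <= C' & forall x : R, 0 < x ->
    `|F x * (x `^ b * expR (- x) * p.[x])| <=
    C' * ((x `^ (e1 + b) + x `^ (e2 + b)) * expR (- 4^-1 * x)).
Proof.
move=> C0 HF; have h4 : 0 < 4^-1 :> R by rewrite invr_gt0.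
have [C2 C20 pC] := horner_le_expR p h4.
exists (C * C2); first exact: mulr_ge0.
move=> x x0; rewrite normrM [`|_ * p.[x]|]normrM.
rewrite (ger0_norm (mulr_ge0 (powR_ge0 x b) (expR_ge0 (- x)))).
apply: (@le_trans _ _ (C * ((x `^ e1 + x `^ e2) * expR (2^-1 * x)) *
    (x `^ b * expR (- x) * (C2 * expR (4^-1 * x))))).
  apply: ler_pM => //; first by rewrite !mulr_ge0 ?powR_ge0 ?expR_ge0.
    exact: HF.
  by apply: ler_wpM2l; [rewrite mulr_ge0 ?powR_ge0 ?expR_ge0|rewrite pC// ltW].
rewrite !(powRDp _ b x0) (_ : - 4^-1 * x = 2^-1 * x + - x + 4^-1 * x); last by field.
by rewrite !expRD le_eqVlt; apply/orP; left; apply/eqP; ring.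
Qed.

Lemma integrable_two_powers (e1 e2 e : R) : -1 < e1 -> -1 < e2 -> 0 < e ->
  mu.-integrable D (EFin \o (fun x => (x `^ e1 + x `^ e2) * expR (- e * x))).
Proof.
move=> h1 h2 e0; have -> : (fun x : R => (x `^ e1 + x `^ e2) * expR (- e * x)) =
    (fun x => x `^ e1 * expR (- e * x) + x `^ e2 * expR (- e * x)).
  by apply/funext => x; rewrite mulrDl.
by apply: integrable_half_lineD; exact: integrable_powR_expR.
Qed.

Lemma weighted_integrable F (b : R) p (e1 e2 C : R) : 0 <= C ->
  (forall x : R, 0 < x -> {for x, continuous F}) ->
  (forall x : R, 0 < x -> `|F x| <= C * ((x `^ e1 + x `^ e2) * expR (2^-1 * x))) ->
  -1 < e1 + b -> -1 < e2 + b ->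
  mu.-integrable D (EFin \o (fun x => F x * (x `^ b * expR (- x) * p.[x]))).
Proof.
move=> C0 cF HF h1 h2; have [C' C'0 H] := weighted_bound b p C0 HF.
apply: (integrable_half_line_le _ H).
  by move=> x x0; apply: continuousM; [exact: cF|exact: weight_continuous].
by apply: integrable_half_lineZ; apply: integrable_two_powers.
Qed.

Lemma weighted_cvg0 F (b : R) p (e1 e2 C : R) : 0 <= C ->
  (forall x : R, 0 < x -> `|F x| <= C * ((x `^ e1 + x `^ e2) * expR (2^-1 * x))) ->
  0 < e1 + b -> 0 < e2 + b ->
  F x * (x `^ b * expR (- x) * p.[x]) @[x --> 0^'+] --> (0 : R) /\
  F x * (x `^ b * expR (- x) * p.[x]) @[x --> +oo] --> (0 : R).
Proof.
move=> C0 HF h1 h2; have [C' C'0 H] := weighted_bound b p C0 HF; split.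
  apply: (@cvg0_at_right _ _ (C' * 2) (Num.min (e1 + b) (e2 + b))).
    by rewrite lt_min h1.
  move=> x /andP[x0 x1]; apply: le_trans (H x x0) _; rewrite -mulrA.
  apply: ler_wpM2l => //; rewrite mulr_natl mulr2n.
  rewrite -[leRHS]mulr1; apply: ler_pM; rewrite ?addr_ge0 ?powR_ge0 ?expR_ge0//.
    by apply: lerD; apply: ger_powR; rewrite ?x0// ge_min lexx ?orbT.
  by rewrite -[leRHS]expR0 ler_expR; lra.
have h4 : 0 < 4^-1 :> R by rewrite invr_gt0.
have [C1 C10 H1] := powR_le_expR (e1 + b + 1) h4 ltr01.
have [C2 C20 H2] := powR_le_expR (e2 + b + 1) h4 ltr01.
apply: (@cvg0_pinfty _ _ (C' * (C1 + C2)) 1) => x x1.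
have x0 : 0 < x by lra.
apply: le_trans (H x x0) _; rewrite -mulrA; apply: ler_wpM2l => //.
have := H1 x x1; have := H2 x x1.
rewrite !(powRDp _ 1 x0) powRr1 ?(ltW x0)// => k2 k1.
rewrite mulNr expRN ler_pdivrMr ?expR_gt0// mulrAC ler_pdivlMr//; lra.
Qed.

End weighted_products.

(** * The part of the function that is flat at the origin *)

Section remainder.
Context {R : realType}.
Notation mu := (@lebesgue_measure R).
Notation D := (`]0%R, +oo[%classic : set R).
Variables (a d b : R) (m k J : nat) (G : nat -> R -> R) (P : {poly R}).
Hypotheses (ad1 : -1 < a + d) (a1 : -1 < a) (b0 : 0 < b).
Hypothesis jG : is_jet G.

(* f is the jet of x^d ln^m(x) g(x), s that of the same function with g replaced by
   its Taylor polynomial P, and r = f - s vanishes to a high order at 0 *)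
Let h i (x : R) := G i x - P^`(i).[x].
Let f := jet_mul (log_jet d m) G.
Let s := jet_mul (log_jet d m) (fun i x => P^`(i).[x]).
Let r := jet_mul (log_jet d m) h.

Hypothesis h_small : forall X, 0 < X -> forall i, (i <= J)%N ->
  exists2 M : R, 0 <= M & forall x, 0 < x <= X -> `|h i x| <= M * x ^+ (J - i).
Hypothesis kJ : (k < J)%N.
Hypothesis dJ : 0 <= d - k%:R - 2 + J%:R.
Hypothesis f_lim : forall i, (i <= k)%N ->
  (fun x : R => expR (- x / 2) * x `^ (a + i%:R + 1) * f i x) @ +oo%R --> (0 : R).
Hypothesis f_tail : mu.-integrable `[b, +oo[%classic
  (fun x => (expR (- x / 2) * x `^ (a + k%:R + 1) * `|f k.+1 x|)%:E).

Let rE i x : r i x = f i x - s i x.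
Proof. exact: jet_mulBr. Qed.

Let jr : is_jet r.
Proof.
apply: is_jet_mul; first exact: is_jet_log.
by apply: is_jet_sub => //; exact: is_jet_poly.
Qed.

Let r_continuous i (x : R) : 0 < x -> {for x, continuous (r i)}.
Proof. by move=> x0; exact: derive_continuous (jr i x0). Qed.

(** The exponent is one less than homogeneity suggests: a factor [1/x] pays for the
    powers of [ln x]. *)
Lemma remainder_near0 i X : (i <= J)%N -> 0 < X -> exists2 C : R, 0 <= C &
  forall x, 0 < x <= X -> `|r i x| <= C * x `^ (d - i%:R - 1 + J%:R).
Proof.
move=> iJ X0; apply: (@sum_bound R i.+1 R
  (fun j x => 'C(i, j)%:R * (log_jet d m j x * h (i - j)%N x))
  (fun x => 0 < x <= X) (fun x => x `^ (d - i%:R - 1 + J%:R))) => j ji.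
have [C1 C10 H1] := log_jet_bound d m j.
have ijJ : (i - j <= J)%N by rewrite (leq_trans (leq_subr _ _)).
have [C2 C20 H2] := h_small X0 ijJ.
exists ('C(i, j)%:R * (C1 * (X ^+ 2 + 1) * C2)).
  by rewrite !mulr_ge0// addr_ge0 ?sqr_ge0.
move=> x /andP[x0 xX]; rewrite normrM normr_nat -mulrA; apply: ler_wpM2l => //.
rewrite normrM; apply: le_trans (ler_pM _ _ (H1 x x0) (H2 x _)) _ => //.
  by rewrite x0.
have -> : d - i%:R - 1 + J%:R = d - j%:R - 1 + (J - (i - j))%:R.
  by rewrite !natrB//; ring.
have -> : d - j%:R + 1 = d - j%:R - 1 + 2%:R by ring.
rewrite !(powRDp _ _%:R x0) !powR_mulrn ?(ltW x0)//.
have y0 : 0 <= x `^ (d - j%:R - 1) by exact: powR_ge0.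
have z0 : 0 <= x ^+ (J - (i - j)) by rewrite exprn_ge0// ltW.
have -> : C1 * (X ^+ 2 + 1) * C2 * (x `^ (d - j%:R - 1) * x ^+ (J - (i - j))) =
    C1 * (x `^ (d - j%:R - 1) * X ^+ 2 + x `^ (d - j%:R - 1)) *
      (C2 * x ^+ (J - (i - j))) by ring.
apply: ler_wpM2r; first exact: mulr_ge0.
apply: ler_wpM2l => //; rewrite lerD2r; apply: ler_wpM2l => //.
by rewrite lerXn2r ?nnegrE// ltW.
Qed.

(** At infinity [s] is negligible against [e^(x/2)] and any power, so [r] inherits
    the hypotheses made on [f] there. *)
Lemma singular_part_far i X c : 0 < X -> exists2 C : R, 0 <= C &
  forall x, X <= x -> `|s i x| <= C * (expR (8^-1 * x) * x `^ (- c)).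
Proof.
move=> X0; apply: (@sum_bound R i.+1 R
  (fun j x => 'C(i, j)%:R * (log_jet d m j x * P^`(i - j).[x]))
  (fun x => X <= x) (fun x => expR (8^-1 * x) * x `^ (- c))) => j ji.
have h16 : 0 < 16^-1 :> R by rewrite invr_gt0.
have [C1 C10 H1] := log_jet_bound d m j.
have [C2 C20 H2] := horner_le_expR P^`(i - j) h16.
have [C3 C30 H3] := powR_le_expR (d - j%:R + 1 + c) h16 X0.
have [C4 C40 H4] := powR_le_expR (d - j%:R - 1 + c) h16 X0.
exists ('C(i, j)%:R * (C1 * (C3 + C4) * C2)).
  by rewrite !mulr_ge0// addr_ge0// ltW.
move=> x Xx; have x0 := lt_le_trans X0 Xx.
rewrite normrM normr_nat -mulrA; apply: ler_wpM2l => //.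
rewrite normrM; apply: le_trans (ler_pM _ _ (H1 x x0) (H2 x (ltW x0))) _ => //.
have -> : C1 * (C3 + C4) * C2 * (expR (8^-1 * x) * x `^ (- c)) =
    C1 * ((C3 + C4) * expR (16^-1 * x) * x `^ (- c)) * (C2 * expR (16^-1 * x)).
  have -> : 8^-1 * x = 16^-1 * x + 16^-1 * x by field.
  by rewrite expRD; ring.
apply: ler_wpM2r; first by rewrite mulr_ge0 ?expR_ge0.
apply: ler_wpM2l => //; rewrite powRN ler_pdivlMr ?powR_gt0// mulrDl -!(powRDp _ c x0).
by have := H3 x Xx; have := H4 x Xx; lra.
Qed.

(** One bound for both ends: it gives the integrability of the [i]-th integrand and
    the vanishing of its boundary terms. *)
Lemma remainder_global i : (i <= k)%N -> exists2 C : R, 0 <= C &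
  forall x, 0 < x -> `|r i x| <=
    C * ((x `^ (d - i%:R - 1 + J%:R) + x `^ (- a - i%:R)) * expR (2^-1 * x)).
Proof.
move=> ik; have /cvgrPdist_lt/(_ 1 ltr01) [X0 [X0r HX]] := f_lim ik.
pose X := Num.max 1 (X0 + 1).
have X1 : 1 <= X by rewrite le_max lexx.
have XX0 : X0 < X by rewrite lt_max ltrDl ltr01 orbT.
have Xgt0 : 0 < X by lra.
have [C1 C10 H1] := remainder_near0 (leq_trans ik (ltnW kJ)) Xgt0.
have [C2 C20 H2] := singular_part_far i (a + i%:R) Xgt0.
exists (C1 + 1 + C2); first by rewrite !addr_ge0.
move=> x x0; set p1 := x `^ _; set p2 := x `^ (- a - i%:R); set E := expR _.
have p10 : 0 <= p1 by exact: powR_ge0.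
have p20 : 0 <= p2 by exact: powR_ge0.
have E1 : 1 <= E by rewrite -[leLHS]expR0 ler_expR; lra.
have E0 : 0 <= E by lra.
have pE1 : 0 <= p1 * E by exact: mulr_ge0.
have pE2 : 0 <= p2 * E by exact: mulr_ge0.
have [xX|Xx] := leP x X.
  apply: (@le_trans _ _ (C1 * (p1 * E))).
    apply: le_trans (H1 x _) _; first by rewrite x0.
    by apply: ler_wpM2l => //; rewrite ler_peMr.
  have := mulr_ge0 C10 pE2; have := mulr_ge0 C20 pE1; have := mulr_ge0 C20 pE2.
  lra.
have x1 : 1 <= x by apply: le_trans X1 (ltW Xx).
have fx : `|f i x| <= p2 * E.
  have := HX x (lt_trans XX0 Xx); rewrite sub0r normrN !normrM.
  rewrite (ger0_norm (expR_ge0 _)) (ger0_norm (powR_ge0 _ _)).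
  have -> : p2 = (x `^ (a + i%:R))^-1 by rewrite -powRN opprD.
  have -> : E = (expR (- x / 2))^-1.
    by rewrite -expRN /E; congr expR; field.
  have q1 : x `^ (a + i%:R) <= x `^ (a + i%:R + 1).
    by apply: ler_powR => //; rewrite lerDl.
  have q0 : 0 < x `^ (a + i%:R) by exact: powR_gt0.
  have e0 := expR_gt0 (- x / 2).
  move=> H; rewrite -invfM -[leRHS]mul1r ler_pdivlMr ?mulr_gt0//.
  apply: le_trans (ltW H); rewrite mulrC; apply: ler_wpM2r => //.
  by rewrite mulrC; apply: ler_wpM2l q1; exact: ltW.
have sx : `|s i x| <= C2 * (p2 * E).
  apply: le_trans (H2 x (ltW Xx)) _; apply: ler_wpM2l => //.
  rewrite mulrC /p2 opprD; apply: ler_wpM2l; first exact: powR_ge0.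
  by rewrite ler_expR; lra.
rewrite rE; apply: le_trans (ler_normB _ _) _; apply: le_trans (lerD fx sx) _.
have := mulr_ge0 C10 pE1; have := mulr_ge0 C10 pE2; have := mulr_ge0 C20 pE1.
lra.
Qed.

Let beta := a + k%:R + 1.
Let q := beta / 2 + 4^-1.

Let beta_gt0 : 0 < beta.
Proof. by have := ler0n R k; have := a1; rewrite /beta; lra. Qed.

Let Phi (x : R) := r k.+1 x * (x `^ beta * expR (- x / 2)) * (1 + x `^ (- q)).

(** [Phi] is the derivative of order [k + 1] against the envelope that the uniform
    bound gives to [x^beta e^(-x) L_n]; the hypothesis on the tail of [f] is exactly its
    integrability at infinity. *)
Lemma remainder_tail_integrable : mu.-integrable D (EFin \o Phi).
Proof.
have [C1 C10 H1] := remainder_near0 kJ b0.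
have [C2 C20 H2] := singular_part_far k.+1 beta b0.
pose C3 := 1 + b `^ (- q).
have C30 : 0 <= C3 by rewrite addr_ge0 ?powR_ge0.
pose e := d - k.+1%:R - 1 + J%:R.
have e0 : 0 <= e by have := dJ; rewrite /e -[k.+1%:R]natr1; lra.
pose T (x : R) := expR (- x / 2) * x `^ beta * `|f k.+1 x|.
pose B : set R := `[b, +oo[%classic.
pose F (x : R) :=
  C1 * ((x `^ (e + beta) + x `^ (e + beta - q)) * expR (- 2^-1 * x)) +
  C2 * C3 * (x `^ 0 * expR (- 4^-1 * x)) + C3 * (T \_ B) x.
have q0 : 0 < q by have := beta_gt0; rewrite /q; lra.
have iT : mu.-integrable D (EFin \o (T \_ B)).
  have : mu.-integrable setT ((EFin \o T) \_ B).
    by rewrite -integrable_mkcond//; exact: measurable_itv.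
  rewrite -restrict_EFin; apply: integrableS => //; exact: measurable_itv.
have iF : mu.-integrable D (EFin \o F).
  apply: integrable_half_lineD; last exact: integrable_half_lineZ.
  apply: integrable_half_lineD; apply: integrable_half_lineZ.
    by apply: integrable_two_powers; have := beta_gt0; rewrite /q; lra.
  by apply: integrable_powR_expR; lra.
apply: (integrable_half_line_le _ _ iF).
  move=> x x0; apply: derive_continuous.
  have de := derR_expR (derR_mul (derR_opp (derR_id x)) (derR_cst x 2^-1)).
  exact: derR_mul (derR_mul (jr k.+1 x0) (derR_mul (derR_powR beta (derR_id x) x0) de))
    (derR_add (derR_cst x 1) (derR_powR (- q) (derR_id x) x0)).
move=> x x0; rewrite /Phi /F.
have w0 : 0 <= x `^ beta * expR (- x / 2) by rewrite mulr_ge0 ?powR_ge0 ?expR_ge0.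
have v0 : 0 <= 1 + x `^ (- q) by rewrite addr_ge0 ?powR_ge0.
have eE : expR (- 2^-1 * x) = expR (- x / 2) by congr expR; field.
have n1 : 0 <= C1 * ((x `^ (e + beta) + x `^ (e + beta - q)) * expR (- 2^-1 * x)).
  by rewrite !mulr_ge0 ?addr_ge0 ?powR_ge0 ?expR_ge0.
have n2 : 0 <= C2 * C3 * (x `^ 0 * expR (- 4^-1 * x)).
  by rewrite !mulr_ge0 ?powR_ge0 ?expR_ge0.
rewrite normrM (ger0_norm v0) normrM (ger0_norm w0).
have [xb|bx] := ltP x b.
  have -> : (T \_ B) x = 0.
    by rewrite patchE memNset// /B /= in_itv/= andbT; apply/negP; rewrite -ltNge.
  rewrite mulr0 addr0; apply: ler_wpDr => //.
  have h1 : `|r k.+1 x| <= C1 * x `^ e by apply: H1; rewrite x0 ltW.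
  apply: le_trans (ler_wpM2r v0 (ler_wpM2r w0 h1)) _.
  rewrite eE (powRDp _ (- q) x0) (powRDp _ beta x0) le_eqVlt; apply/orP; left.
  by apply/eqP; ring.
have xB : x \in B by rewrite inE /B /= in_itv/= andbT.
rewrite patchE xB; apply: (@le_trans _ _
  ((`|f k.+1 x| + C2 * (expR (8^-1 * x) * x `^ (- beta))) *
   (x `^ beta * expR (- x / 2)) * C3)).
  apply: ler_pM => //; first by rewrite mulr_ge0.
    apply: ler_wpM2r => //; rewrite rE; apply: le_trans (ler_normB _ _) _.
    by rewrite lerD2l; apply: H2.
  rewrite lerD2l !powRN lef_pV2 ?posrE ?powR_gt0//; apply: ge0_ler_powR => //.
  - exact: ltW.
  - by rewrite nnegrE ltW.
  - by rewrite nnegrE ltW.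
rewrite -addrA; apply: ler_wpDl => //; rewrite addrC /T powRr0 mul1r.
have bN0 : x `^ beta != 0 by rewrite gt_eqF// powR_gt0.
have -> : (`|f k.+1 x| + C2 * (expR (8^-1 * x) * x `^ (- beta))) *
   (x `^ beta * expR (- x / 2)) * C3 =
   C3 * (expR (- x / 2) * x `^ beta * `|f k.+1 x|) +
   C2 * C3 * (expR (8^-1 * x) * expR (- x / 2)).
  by rewrite powRN; field.
rewrite lerD2l; apply: ler_wpM2l; first exact: mulr_ge0.
by rewrite -expRD ler_expR; lra.
Qed.

Let term i n (x : R) :=
  r i x * (x `^ (a + i%:R) * expR (- x) * (laguerre (a + i%:R) n).[x]).

Let term_continuous i n (x : R) : 0 < x -> {for x, continuous (term i n)}.
Proof.
by move=> x0; apply: continuousM; [exact: r_continuous|exact: weight_continuous].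
Qed.

Let betaE : a + k.+1%:R = beta. Proof. by rewrite /beta -natr1 addrA. Qed.

(** On the top derivative, the bound [e^(-x/2) |L_n x| <= c (1 + x^(-q))]
    compares the integrand with [c Phi]. *)
Let term_top_le n (c : R) (x : R) : 0 < x -> 0 <= c ->
  expR (- x / 2) * `|(laguerre beta n).[x]| <= c * (1 + x `^ (- q)) ->
  `|term k.+1 n x| <= c * `|Phi x|.
Proof.
move=> x0 c0 H; rewrite /term /Phi betaE.
have v0 : 0 <= 1 + x `^ (- q) by rewrite addr_ge0 ?powR_ge0.
have w0 : 0 <= x `^ beta by exact: powR_ge0.
have e0 : 0 <= expR (- x / 2) by exact: expR_ge0.
have -> : expR (- x) = expR (- x / 2) * expR (- x / 2).
  by rewrite -expRD; congr expR; field.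
rewrite !normrM (ger0_norm v0) (ger0_norm w0) (ger0_norm e0).
have -> : c * (`|r k.+1 x| * (x `^ beta * expR (- x / 2)) * (1 + x `^ (- q))) =
  `|r k.+1 x| * (x `^ beta * expR (- x / 2)) * (c * (1 + x `^ (- q))) by ring.
have -> : `|r k.+1 x| * (x `^ beta * (expR (- x / 2) * expR (- x / 2)) *
    `|(laguerre beta n).[x]|) =
  `|r k.+1 x| * (x `^ beta * expR (- x / 2)) *
    (expR (- x / 2) * `|(laguerre beta n).[x]|) by ring.
by apply: ler_wpM2l H; rewrite mulr_ge0// mulr_ge0.
Qed.

Let iPhi : mu.-integrable D (EFin \o (fun x => `|Phi x|)).
Proof. by have := integrable_norm remainder_tail_integrable. Qed.

Let term_integrable i n : (i <= k.+1)%N -> mu.-integrable D (EFin \o term i n).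
Proof.
rewrite leq_eqVlt => /orP[/eqP ->|]; last first.
  rewrite ltnS => ik; have [C C0 HC] := remainder_global ik.
  apply: (weighted_integrable (laguerre (a + i%:R) n) C0 _ HC).
  - by move=> x; exact: r_continuous.
  - have J1 : 1 <= J%:R :> R by rewrite ler1n (leq_trans _ kJ).
    have := ad1; lra.
  - lra.
have h2 : 0 < 2^-1 :> R by rewrite invr_gt0.
have [C C0 HC] := horner_le_expR (laguerre beta n) h2.
apply: (integrable_half_line_le _ _ (integrable_half_lineZ C iPhi)).
  by move=> x; exact: term_continuous.
move=> x x0; apply: term_top_le => //.
have -> : - x / 2 = - (2^-1 * x) by field.
rewrite expRN mulrC ler_pdivrMr ?expR_gt0//.
apply: le_trans (HC x (ltW x0)) _; apply: ler_wpM2r; first exact: expR_ge0.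
by rewrite ler_peMr// lerDl powR_ge0.
Qed.

Let RI i n := \int[mu]_(x in D) term i n x.

(** Each integration by parts raises the parameter by 1, lowers the degree by 1 and
    gains a factor [1 / (n + 1)]. *)
Let RI_by_parts i n : (i <= k)%N -> n.+1%:R * RI i n.+1 = - RI i.+1 n.
Proof.
move=> ik; have [C C0 HC] := remainder_global ik.
have J1 : 1 <= J%:R :> R by rewrite ler1n (leq_trans _ kJ).
have iE : a + i.+1%:R = a + i%:R + 1 by rewrite -natr1 addrA.
have [||l0 ly] := @weighted_cvg0 R (r i) (a + i%:R + 1)
  (laguerre (a + i%:R + 1) n) _ _ C C0 HC.
- by have := ad1; lra.
- by lra.
pose H (x : R) := r i x * (x `^ (a + i%:R + 1) * expR (- x) *
  (laguerre (a + i%:R + 1) n).[x]).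
have dH (x : R) : 0 < x -> is_derive x 1 H (n.+1%:R * term i n.+1 x + term i.+1 n x).
  move=> x0; apply: derR_eq (derR_mul (jr i x0)
    (weighted_laguerre_derive (a + i%:R) n x0)) _.
  by rewrite /term iE; ring.
have cU (x : R) : 0 < x -> {for x, continuous (fun y => n.+1%:R * term i n.+1 y)}.
  move=> x0; apply: continuousM; first exact: cst_continuous.
  exact: term_continuous.
have := Rintegral_by_parts dH cU (@term_continuous i.+1 n)
  (integrable_half_lineZ n.+1%:R (term_integrable n.+1 (leqW ik)))
  (@term_integrable i.+1 n ik) l0 ly.
by rewrite RintegralZl; [|exact: measurable_itv|exact: term_integrable (leqW ik)].
Qed.

Let RI_chain i n : (i <= k.+1)%N -> `|RI 0 (n + i)| * n%:R ^+ i <= `|RI i n|.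
Proof.
elim: i n => [|i IH] n ik; first by rewrite addn0 expr0 mulr1.
have := IH n.+1 (ltnW ik); rewrite addSnnS => {}IH.
have := RI_by_parts n ik => /(congr1 Num.norm).
rewrite normrN normrM normr_nat => <-.
have nn : n%:R <= n.+1%:R :> R by rewrite ler_nat.
rewrite exprS mulrCA; apply: ler_pM; [exact: ler0n| |exact: nn|].
  by rewrite mulr_ge0 ?exprn_ge0.
apply: le_trans IH; apply: ler_wpM2l => //.
by rewrite lerXn2r ?nnegrE.
Qed.

Lemma remainder_integrable n : mu.-integrable D (EFin \o
  (fun x => r 0 x * (x `^ a * expR (- x) * (laguerre a n).[x]))).
Proof. by have := term_integrable n (leq0n k.+1); rewrite /term addr0. Qed.

(** The [k + 1] integrations by parts gain [n^(-k-1)], the uniform bound with the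
    parameter [beta = a + k + 1] costs [n^(beta/2 - 1/4)], and the total exponent
    [(a - k - 1)/2 - 1/4] is at most [- d - 1] by the choice of [k]. *)
Lemma remainder_growth : a + 2 * d + 2^-1 <= k%:R ->
  exists (C : R) (n0 : nat), 0 <= C /\ forall n, (n0 <= n)%N ->
  `|\int[mu]_(x in D) (r 0 x * (x `^ a * expR (- x) * (laguerre a n).[x]))| <=
  C * n%:R `^ (- d - 1).
Proof.
move=> kd; have [Cs [ns [Cs0 HL]]] := laguerre_sup_bound beta_gt0.
pose I := \int[mu]_(x in D) `|Phi x|.
have I0 : 0 <= I by apply: Rintegral_ge0.
pose t := beta / 2 - 4^-1 - k.+1%:R.
have top n : (ns <= n)%N -> `|RI k.+1 n| <= Cs * n%:R `^ (beta / 2 - 4^-1) * I.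
  move=> nsn; have c0 : 0 <= Cs * n%:R `^ (beta / 2 - 4^-1).
    by rewrite mulr_ge0 ?powR_ge0// ltW.
  rewrite /I -RintegralZl; [|exact: measurable_itv|exact: iPhi].
  apply: normr_Rintegral_le; [exact: term_integrable|exact: integrable_half_lineZ|].
  by move=> x x0; apply: term_top_le => //; apply: HL.
exists (Cs * I * 2 `^ `|t|), (ns + k.+1 + k.+1)%N; split.
  by rewrite !mulr_ge0 ?powR_ge0// ltW.
move=> n nn; pose l := (n - k.+1)%N.
have kn : (k.+1 <= n)%N by rewrite (leq_trans _ nn)// leq_addl.
have nE : n = (l + k.+1)%N by rewrite subnK.
have km : (k.+1 <= l)%N.
  by rewrite -(leq_add2r k.+1) -nE (leq_trans _ nn)// -addnA leq_addl.
have nsm : (ns <= l)%N by rewrite -(leq_add2r k.+1) -nE (leq_trans (leq_addr _ _) nn).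
have m0 : 0 < l%:R :> R by rewrite ltr0n (leq_trans _ km).
have n0 : 0 < n%:R :> R by rewrite ltr0n (leq_trans _ kn).
have -> : \int[mu]_(x in D) (r 0 x * (x `^ a * expR (- x) * (laguerre a n).[x])) =
    RI 0 n by rewrite /RI /term addr0.
have := le_trans (RI_chain l (leqnn _)) (top l nsm); rewrite -nE => H.
have mt : l%:R `^ (beta / 2 - 4^-1) = l%:R `^ t * l%:R ^+ k.+1.
  by rewrite -powR_mulrn ?(ltW m0)// -powRDp// /t subrK.
have {}H : `|RI 0 n| <= Cs * I * l%:R `^ t.
  rewrite -(ler_pM2r (exprn_gt0 k.+1 m0)); apply: le_trans H _.
  by rewrite mt le_eqVlt; apply/orP; left; apply/eqP; ring.
apply: le_trans H _; rewrite -[leRHS]mulrA; apply: ler_wpM2l.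
  by rewrite mulr_ge0// ltW.
have mn : l%:R `^ t <= 2 `^ `|t| * n%:R `^ t.
  apply: powR_comparable => //.
    rewrite (@le_trans _ _ n%:R)//; first by rewrite ler_nat leq_subr.
    by rewrite ler_peMl ?ler1n// ltW.
  by rewrite -natrM ler_nat nE mul2n -addnn leq_add2l.
apply: le_trans mn _; apply: ler_wpM2l; first exact: powR_ge0.
apply: ler_powR; first by rewrite ler1n (leq_trans _ kn).
by rewrite /t /beta -[k.+1%:R]natr1; lra.
Qed.

End remainder.

(** * The singular part, and the conclusion *)

Section singular_part.
Context {R : realType}.
Notation mu := (@lebesgue_measure R).
Notation D := (`]0%R, +oo[%classic : set R).

Lemma ln_2sqrt_ge n : (0 < n)%N -> ln 2 <= ln (2 * Num.sqrt n%:R) :> R.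
Proof.
move=> n0; rewrite ler_ln ?posrE ?mulr_gt0 ?sqrtr_gt0 ?ltr0n//.
by apply: ler_peMr => //; rewrite -[leLHS]sqrtr1 ler_sqrt ?ler1n ?ler0n.
Qed.

(** A polynomial factor is absorbed by shifting the exponent [d]. *)
Lemma log_poly_laguerre_moment_growth (a : R) m (p : {poly R}) (d : R) :
  -1 < a + d -> exists (C : R) (n0 : nat), 0 <= C /\
  forall n, (n0 <= n)%N ->
    `|\int[mu]_(x in D) log_moment_fun (a + d) m (p * laguerre a n) x| <=
    C * n%:R `^ (- d - 1) * ln (2 * Num.sqrt n%:R) ^+ m.
Proof.
elim/poly_ind: p d => [|p c IH] d ad1.
  exists 0, 0%N; split => // n _; rewrite !mul0r.
  under eq_Rintegral => x _ do rewrite /log_moment_fun horner0 mulr0 mul0r.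
  by rewrite /Rintegral integral0/= normr0.
have ad2 : -1 < a + (d + 1) by lra.
have [C1 [n1 [C10 H1]]] := IH (d + 1) ad2.
have [C2 [n2 [n20 H2]]] := log_laguerre_moment_growth ad1 m.
exists (C1 + `|c| * `|C2|), (n1 + n2)%N; split; first by rewrite addr_ge0 ?mulr_ge0.
move=> n nn; have n1n : (n1 <= n)%N by rewrite (leq_trans _ nn)// leq_addr.
have n2n : (n2 <= n)%N by rewrite (leq_trans _ nn)// leq_addl.
have n0 : (0 < n)%N by exact: leq_trans n2n.
have nR : 1 <= n%:R :> R by rewrite ler1n.
have l0 : 0 <= ln (2 * Num.sqrt n%:R) :> R.
  by apply: le_trans (ln_2sqrt_ge n0); rewrite ln_ge0// ler1n.
have -> : \int[mu]_(x in D) log_moment_fun (a + d) m ((p * 'X + c%:P) * laguerre a n) x =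
    \int[mu]_(x in D) (log_moment_fun (a + (d + 1)) m (p * laguerre a n) x +
      c * log_moment_fun (a + d) m (laguerre a n) x).
  apply: eq_Rintegral => x; rewrite inE /= in_itv/= andbT => x0.
  rewrite /log_moment_fun !hornerM hornerD hornerM hornerX hornerC.
  rewrite (addrA a d 1) (powRDp (a + d) 1 x0) powRr1 ?(ltW x0)//; ring.
have i1 := integrable_log_moment_fun m (p * laguerre a n) ad2.
have i2 := integrable_log_moment_fun m (laguerre a n) ad1.
rewrite RintegralD; [|exact: measurable_itv|exact: i1|exact: integrable_half_lineZ].
rewrite RintegralZl; [|exact: measurable_itv|exact: i2].
apply: le_trans (ler_normD _ _) _; rewrite mulrDl mulrDl; apply: lerD.
  apply: le_trans (H1 n n1n) _; apply: ler_wpM2r; first exact: exprn_ge0.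
  by apply: ler_wpM2l => //; apply: ler_powR => //; lra.
rewrite normrM -!mulrA; apply: ler_wpM2l => //.
apply: le_trans (H2 n n2n) _; rewrite -mulrA; apply: ler_wpM2r.
  by rewrite mulr_ge0 ?powR_ge0 ?exprn_ge0.
exact: ler_norm.
Qed.

End singular_part.

Theorem theorem4p1 (R : realType) (alpha delta : R) (mu k : nat) (b : R)
    (f g : R -> R)
    (alpha_gtN1 : -1 < alpha)
    (alphaD_gtN1 : -1 < alpha + delta)
    (g_smooth : smooth_half_line g)
    (fE : forall x : R, 0 < x -> f x = x `^ delta * ln x ^+ mu * g x)
    (f_int : lebesgue_measure.-integrable (`]0, +oo[ : set R)
               (fun x : R => (expR (- x) * x `^ alpha * f x)%:E))
    (k_ge : alpha + 2 * delta + 2^-1 <= k%:R)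
    (k_min : forall m : nat, alpha + 2 * delta + 2^-1 <= m%:R -> (k <= m)%N)
    (f_lim : forall i : nat, (i <= k)%N ->
       (fun x : R => expR (- x / 2) * x `^ (alpha + i%:R + 1) * derive1n i f x)
         @ +oo%R --> (0 : R))
    (b_gt0 : 0 < b)
    (f_tail : (\int[lebesgue_measure]_(x in `[b, +oo[)
                 (expR (- x / 2) * x `^ (alpha + k%:R + 1)
                   * `|derive1n k.+1 f x|)%:E < +oo)%E) :
  (fun n : nat => `|laguerre_coef alpha f n|) =O_\oo
    (fun n : nat => n%:R `^ (- alpha - delta - 1) * ln (2 * Num.sqrt n%:R) ^+ mu).
Proof.
have [G [G0 Gd]] := g_smooth.
have jG : is_jet G := half_line_jet Gd.
pose D : set R := `]0%R, +oo[%classic.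
pose F := jet_mul (log_jet delta mu) G.
have jF : is_jet F by apply: is_jet_mul => //; exact: is_jet_log.
have jet_mul0 H (x : R) : jet_mul (log_jet delta mu) H 0 x =
    x `^ delta * ln x ^+ mu * H 0%N x.
  by rewrite /jet_mul big_ord_recl big_ord0 addr0 bin0 mul1r log_jet0.
have fF (x : R) : 0 < x -> f x = F 0%N x.
  by move=> x0; rewrite fE// /F jet_mul0 G0// ltW.
have dF := derive1n_jet jF fF.
(* J is large enough for the derivative of order k + 1 of the remainder to be
   bounded near 0 *)
pose J := (k + 2 + Num.bound `|delta|)%N.
pose P := \poly_(j < J) (G j 0 / j`!%:R).
have kJ : (k < J)%N by rewrite /J -addnA -addn1 leq_add2l addn_gt0.
have dJ : 0 <= delta - k%:R - 2 + J%:R.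
  have : `|delta| < (Num.bound `|delta|)%:R by exact: archi_boundP.
  have := ler_norm (- delta); rewrite normrN /J !natrD; lra.
have F_lim i : (i <= k)%N ->
    (fun x : R => expR (- x / 2) * x `^ (alpha + i%:R + 1) * F i x) @ +oo%R --> (0 : R).
  move=> ik; apply: cvg_trans (f_lim i ik); apply: near_eq_cvg.
  near=> x; rewrite dF//; near: x; exact: nbhs_pinfty_gt.
have B_sub : `[b, +oo[%classic `<=` D.
  by move=> x; rewrite /D /= !in_itv/= !andbT; exact: lt_le_trans.
have F_tail : lebesgue_measure.-integrable (`[b, +oo[%classic : set R)
    (fun x => (expR (- x / 2) * x `^ (alpha + k%:R + 1) * `|F k.+1 x|)%:E).
  apply/integrableP; split.
    apply/measurable_EFinP; apply: (measurable_funS (measurable_itv _) B_sub).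
    apply: measurable_fun_half_line => x x0.
    have de := derR_expR (derR_mul (derR_opp (derR_id x)) (derR_cst x 2^-1)).
    apply: continuousM.
      exact: derive_continuous (derR_mul de (derR_powR _ (derR_id x) x0)).
    apply: continuous_comp; first exact: derive_continuous (jF k.+1 x x0).
    exact: norm_continuous.
  apply: le_lt_trans f_tail; rewrite le_eqVlt; apply/orP; left; apply/eqP.
  apply: eq_integral => x; rewrite inE => /B_sub xD.
  have x0 : 0 < x by move: xD; rewrite /D /= in_itv/= andbT.
  rewrite dF//= ger0_norm//; apply: mulr_ge0 => //.
  by rewrite mulr_ge0 ?expR_ge0 ?powR_ge0.
have h_small X (X0 : 0 < X) := taylor_remainder Gd (J := J) X0.
pose r := jet_mul (log_jet delta mu) (fun i x => G i x - P^`(i).[x]).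
have [C1 [n1 [C10 H1]]] :=
  log_poly_laguerre_moment_growth mu P alphaD_gtN1.
have [C2 [n2 [C20 H2]]] := remainder_growth alphaD_gtN1 alpha_gtN1 b_gt0 jG
  h_small kJ dJ F_lim F_tail k_ge.
have [C3 C30 H3] := laguerre_sigma_inv_growth alpha_gtN1.
have l20 : 0 < ln 2 :> R by rewrite ln_gt0// ltr1n.
apply/eqO_exP; exists (C3 * (C1 + C2 * (ln 2)^-1 ^+ mu) + 1).
  by rewrite ltr_wpDl// mulr_ge0 ?addr_ge0 ?mulr_ge0 ?exprn_ge0 ?invr_ge0// ltW.
exists (n1 + n2 + 1)%N => // n /= nn.
have n0 : (0 < n)%N by rewrite (leq_trans _ nn)// addn1.
have nR : 0 < n%:R :> R by rewrite ltr0n.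
have n1n : (n1 <= n)%N by rewrite (leq_trans _ nn)// -addnA leq_addr.
have n2n : (n2 <= n)%N by rewrite (leq_trans _ nn)// addnAC leq_addl.
have L2 := @ln_2sqrt_ge R n n0.
pose l : R := ln (2 * Num.sqrt n%:R); rewrite -/l in L2 *.
have l0 : 0 < l by exact: lt_le_trans L2.
have lmu : 1 <= (ln 2)^-1 ^+ mu * l ^+ mu.
  by rewrite -exprMn exprn_ege1// ler_pdivlMl// mulr1.
rewrite normr_id [X in _ <= _ * X]ger0_norm; last first.
  by rewrite mulr_ge0 ?powR_ge0 ?exprn_ge0// ltW.
rewrite /laguerre_coef normrM.
have -> : \int[lebesgue_measure]_(x in `]0, +oo[)
    (f x * (laguerre alpha n).[x] * laguerre_weight alpha x) =
  \int[lebesgue_measure]_(x in D)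
    (log_moment_fun (alpha + delta) mu (P * laguerre alpha n) x +
     r 0%N x * (x `^ alpha * expR (- x) * (laguerre alpha n).[x])).
  apply: eq_Rintegral => x; rewrite inE /= in_itv/= andbT => x0.
  rewrite fF// /F /r !jet_mul0 /log_moment_fun /laguerre_weight derivn0 hornerM.
  by rewrite (powRDp alpha delta x0); ring.
rewrite RintegralD; [|exact: measurable_itv| |]; last 2 first.
- exact: integrable_log_moment_fun.
- exact: (remainder_integrable alphaD_gtN1 alpha_gtN1 b_gt0 jG h_small kJ dJ F_lim F_tail).
have {}H1 := H1 n n1n; have {}H2 := H2 n n2n; have {}H3 := H3 n n0.
set A := \int[_]_(x in _) _ in H1 *; set B := \int[_]_(x in _) _ in H2 *.
have AB : `|A + B| <= (C1 + C2 * (ln 2)^-1 ^+ mu) * (n%:R `^ (- delta - 1) * l ^+ mu).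
  apply: le_trans (ler_normD _ _) _; rewrite mulrDl; apply: lerD.
    by rewrite mulrA.
  apply: le_trans H2 _; rewrite -mulrA; apply: ler_wpM2l => //.
  by rewrite mulrCA ler_peMr ?powR_ge0.
apply: le_trans (ler_pM _ _ H3 AB) _ => //.
have -> : - alpha - delta - 1 = - alpha + (- delta - 1) by ring.
rewrite (powRDp (- alpha) _ nR) [leRHS]mulrDl mul1r; apply: ler_wpDr.
  by rewrite !mulr_ge0 ?powR_ge0 ?exprn_ge0// ltW.
by rewrite le_eqVlt; apply/orP; left; apply/eqP; ring.
Unshelve. all: by end_near. Qed.
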